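(* Let $1<\alpha\le 2$ and let $\lambda_1^*$ be the largest negative zero of the function $\lambda\mapsto E_{\alpha,\alpha-1}(\lambda)$. For $\lambda\in\mathbb{R}$ with $E_{\alpha,\alpha-1}(\lambda)\ne 0$, let $G$ be the Green's function of the problem $D^{\alpha}u(t)-\lambda u(t)+y(t)=0$, $t\in[0,1]$, $\lim_{t\to0^+}t^{2-\alpha}u(t)=u'(1)=0$. Then $$G(t,s)>0\ \text{ for all } t,s\in(0,1)\quad\text{if and only if}\quad \lambda>\lambda_1^*.$$
   Context: The two-parameter Mittag-Leffler function is $E_{\alpha,\beta}(x)=\sum_{k=0}^\infty \frac{x^k}{\Gamma(\alpha k+\beta)}$ for $\alpha,\beta>0$, $x\in\mathbb{R}$. $D^\alpha$ is the Riemann-Liouville fractional derivative with base point $0$: $D^\alpha f(t)=\frac{1}{\Gamma(n-\alpha)}\frac{d^n}{dt^n}\int_0^t (t-s)^{n-\alpha-1}f(s)\,ds$, $n=[\alpha]+1$. The Green's function is, explicitly, $$G(t,s)=\begin{cases}\dfrac{t^{\alpha-1}E_{\alpha,\alpha}(\lambda t^\alpha)\,E_{\alpha,\alpha-1}(\lambda(1-s)^\alpha)}{(1-s)^{2-\alpha}E_{\alpha,\alpha-1}(\lambda)}-(t-s)^{\alpha-1}E_{\alpha,\alpha}(\lambda(t-s)^\alpha), & 0\le s\le t\le 1,\ s<1,\\[3mm] \dfrac{t^{\alpha-1}E_{\alpha,\alpha}(\lambda t^\alpha)\,E_{\alpha,\alpha-1}(\lambda(1-s)^\alpha)}{(1-s)^{2-\alpha}E_{\alpha,\alpha-1}(\lambda)},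 & 0\le t<s<1.\end{cases}$$ *)

(* Defs.v *)
From HB Require Import structures.
From mathcomp Require Import all_boot all_order all_algebra.
From mathcomp Require Import all_classical all_reals all_analysis.

Set Implicit Arguments.
Unset Strict Implicit.
Unset Printing Implicit Defensive.

Import Order.TTheory GRing.Theory Num.Theory.
Import numFieldNormedType.Exports.

Local Open Scope classical_set_scope.
Local Open Scope ring_scope.

(* Euler's integral; meaningful for 0 < z, the only case used below. *)
Definition Gamma {R : realType} (z : R) : R :=
  \int[lebesgue_measure]_(t in `]0, +oo[) (t `^ (z - 1) * expR (- t)).

Definition mittag_leffler {R : realType} (alpha beta x : R) : R :=
  limn (series (fun k : nat => x ^+ k / Gamma (alpha * k%:R + beta))).

Definition largest_negative_zero {R : realType} (f : R -> R) (x : R) : Prop :=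
  [/\ x < 0, f x = 0 & forall y : R, y < 0 -> f y = 0 -> y <= x].

(* Green's function of D^alpha u - lambda u + y = 0 on [0, 1] (D^alpha the
   Riemann-Liouville derivative based at 0) with boundary conditions
   lim_(t -> 0+) t^(2 - alpha) u(t) = u'(1) = 0. It is meaningful for
   0 <= t <= 1 and 0 <= s < 1 when
   mittag_leffler alpha (alpha - 1) lambda != 0. *)
Definition green {R : realType} (alpha lambda t s : R) : R :=
  let E := mittag_leffler alpha in
  let P :=
    (t `^ (alpha - 1) * E alpha (lambda * t `^ alpha)
       * E (alpha - 1) (lambda * (1 - s) `^ alpha))
    / ((1 - s) `^ (2 - alpha) * E (alpha - 1) lambda) in
  if s <= t then
    P - (t - s) `^ (alpha - 1) * E alpha (lambda * (t - s) `^ alpha)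
  else P.

(* Main.v *)
Require Import Defs.
From mathcomp Require Import all_boot all_order all_algebra.
From mathcomp Require Import all_classical all_reals all_analysis.
From mathcomp Require Import measurable_realfun ring lra.
Import Order.TTheory GRing.Theory Num.Theory.
Import numFieldNormedType.Exports.

(* Write a for alpha and l for lambda, and put f(x) = x^(a-1) E_{a,a}(l x^a), so
   that f'(x) = x^(a-2) E_{a,a-1}(l x^a) and
   G(t,s) = f(t) f'(1-s) / f'(1) - f(t-s) for s <= t, without the last term for
   t < s.

   If l < lambda1, then f' vanishes at x = (lambda1 / l)^(1/a) in (0,1), so
   G(t, 1 - x) = 0 for t < 1 - x.

   If lambda1 < l, then f' > 0 on (0,1], and the inequality G > 0 follows from
   the strict log-concavity of f on (0,1], i.e. from f'^2 - f f'' > 0. This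
   holds near 0. For a = 2 the difference is constant. For a < 2, let t be its
   first zero and r = f'(t)/f(t). Then w = f' - r f is positive on (0,t) with
   w(t) = w'(t) = 0. By the beta integral, the fractional integral
   W(x) = int_0^x w(s) (x-s)^(1-a) ds satisfies W'' = Gamma(2-a) l w, hence
   W''(t) = 0. But the kernel is convex and w has a double zero at t, so the
   second difference W(t+2h) - 2 W(t+h) + W(t) is at least a positive multiple
   of h^2 for small h, a contradiction. *)

Set Implicit Arguments.
Unset Strict Implicit.
Unset Printing Implicit Defensive.
Local Open Scope classical_set_scope.
Local Open Scope ring_scope.

(** * Euler's integrals *)

Section euler_integrals.
Context {R : realType}.
Implicit Types (p q c d u x M : R).
Notation mu := (@lebesgue_measure R).

(** Lebesgue measure equals [c] times its image under [x |-> c * x + d]: both measures agree on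
    half-open intervals, which determine them. *)
Lemma ge0_integral_affine c d (f : R -> \bar R) : 0 < c ->
  measurable_fun [set: R] f -> (forall x, (0 <= f x)%E) ->
  (\int[mu]_x f x = c%:E * \int[mu]_x f (c * x + d)%R)%E.
Proof.
move=> c0 mf f0.
pose phi : measurableTypeR R -> measurableTypeR R := fun x => c * x + d.
have mphi : measurable_fun [set: R] phi.
  by apply: measurable_funD => //; exact: measurable_funM.
pose r : {nonneg R} := NngNum (ltW c0).
pose nu0 := (mscale r (pushforward mu phi)) : {measure set (measurableTypeR R) -> \bar R}.
  pose nu := nu0 mphi.
have muE A : measurable A -> mu A = nu A.
  apply: lebesgue_measure_unique => _ [[a b]] _ <- /=.
  rewrite /nu /nu0/= /mscale/= /pushforward.
  have -> : phi @^-1` `]a, b]%classic = `](a - d) / c, (b - d) / c]%classic.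
    apply/seteqP; split => x /=; rewrite !in_itv/= /phi.
      by rewrite ltr_pdivrMr// ler_pdivlMr// mulrC ltrBlDr lerBrDr.
    by rewrite ltr_pdivrMr// ler_pdivlMr// mulrC ltrBlDr lerBrDr.
  rewrite !lebesgue_measure_itv/= !lte_fin ltr_pM2r ?invr_gt0// ltrD2r.
  case: ifP => ab; last by rewrite mule0.
  by rewrite -EFinB -EFinM; congr EFin; field; rewrite gt_eqF.
transitivity (\int[nu]_x f x)%E.
  by apply: eq_measure_integral => A mA _; exact: muE.
rewrite ge0_integral_mscale//=; congr (_ * _)%E.
by rewrite ge0_integral_pushforward.
Qed.

(* Truncated at 0, so that convolutions are integrals over the whole line. *)
Definition pospow p x : R := if 0 < x then x `^ (p - 1) else 0.

Lemma pospow_ge0 p x : 0 <= pospow p x.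
Proof. by rewrite /pospow; case: ifP => // _; exact: powR_ge0. Qed.

Lemma pospow_gt0 p x : 0 < x -> pospow p x = x `^ (p - 1).
Proof. by rewrite /pospow => ->. Qed.

Lemma pospow_le0 p x : x <= 0 -> pospow p x = 0.
Proof. by rewrite /pospow ltNge => ->. Qed.

Lemma measurable_pospow p : measurable_fun [set: R] (pospow p).
Proof.
apply: measurable_fun_if => //=.
  exact: measurable_fun_ltr.
apply: measurable_funS (measurable_powR _) => //.
Qed.

(** Extended-real integrals, so that Tonelli and scaling apply before any convergence is known;
    finiteness is derived afterwards. [convpow p q 1] is Euler's beta integral B(p, q). *)
Definition gammae p : \bar R := \int[mu]_t (pospow p t * expR (- t))%:E.
Definition convpow p q u : \bar R :=
  \int[mu]_s (pospow p s * pospow q (u - s))%:E.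

Lemma GammaE p : Gamma p = fine (gammae p).
Proof.
rewrite /Gamma /Rintegral /gammae integral_mkcond; congr fine.
apply: eq_integral => t _; rewrite patchE /pospow.
case: ifPn => [|].
  by rewrite inE/= in_itv/= andbT => ->.
rewrite notin_setE/= in_itv/= andbT => /negP/negbTE ->.
by rewrite mul0r.
Qed.

Lemma measurable_gammae_fun p :
  measurable_fun [set: R] (fun t => (pospow p t * expR (- t))%:E).
Proof.
apply/measurable_EFinP; apply: measurable_funM; first exact: measurable_pospow.
by apply: measurableT_comp => //.
Qed.

Lemma measurable_convpow_fun p q u :
  measurable_fun [set: R] (fun s => (pospow p s * pospow q (u - s))%:E).
Proof.
apply/measurable_EFinP; apply: measurable_funM; first exact: measurable_pospow.
apply: measurableT_comp; first exact: measurable_pospow.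
exact: measurable_funB.
Qed.

Lemma gammae_ge0 p : (0 <= gammae p)%E.
Proof. by apply: integral_ge0 => x _; rewrite lee_fin mulr_ge0// ?expR_ge0// pospow_ge0. Qed.

Lemma convpow_ge0 p q u : (0 <= convpow p q u)%E.
Proof. by apply: integral_ge0 => x _; rewrite lee_fin mulr_ge0// ?pospow_ge0. Qed.

(** Translate the inner variable by [s], so that the two exponentials merge into exp(-u), then
    exchange the integrals by Tonelli. *)
Lemma gammaeM p q :
  (gammae p * gammae q = \int[mu]_u ((expR (- u))%:E * convpow p q u))%E.
Proof.
have e0 (x : R) := expR_ge0 x.
transitivity (\int[mu]_s ((pospow p s * expR (- s))%:E * gammae q))%E.
  apply/esym/ge0_integralZr => //.
  - exact: measurable_gammae_fun.
  - by move=> x _; rewrite lee_fin mulr_ge0// pospow_ge0.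
  - exact: gammae_ge0.
transitivity (\int[mu]_s \int[mu]_u
    (pospow p s * pospow q (u - s) * expR (- u))%:E)%E.
  apply: eq_integral => s _.
  rewrite /gammae (@ge0_integral_affine 1 (- s))//; last 2 first.
  - exact: measurable_gammae_fun.
  - by move=> x; rewrite lee_fin mulr_ge0// pospow_ge0.
  rewrite mul1e -ge0_integralZl//.
  - apply: eq_integral => u _; rewrite -EFinM mul1r; congr EFin.
    rewrite mulrACA mulrA -mulrA -expRD; congr (_ * expR _); ring.
  - apply/measurable_EFinP; apply: measurable_funM.
      apply: measurableT_comp; first exact: measurable_pospow.
      by apply: measurable_funD => //; apply: measurable_funM.
    apply: measurableT_comp => //; apply: measurableT_comp => //.
    by apply: measurable_funD => //; apply: measurable_funM.
  - by move=> x _; rewrite lee_fin mulr_ge0// pospow_ge0.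
  - by rewrite lee_fin mulr_ge0// pospow_ge0.
rewrite (@fubini_tonelli _ _ _ _ _ mu mu
    (fun z : R * R => (pospow p z.1 * pospow q (z.2 - z.1) * expR (- z.2))%:E)); last 2 first.
- apply/measurable_EFinP; apply: measurable_funM.
    apply: measurable_funM.
      by apply: measurableT_comp; [exact: measurable_pospow|exact: measurable_fst].
    apply: measurableT_comp; first exact: measurable_pospow.
    by apply: measurable_funB; [exact: measurable_snd|exact: measurable_fst].
  apply: measurableT_comp => //; apply: measurableT_comp => //.
- by move=> x; rewrite lee_fin !mulr_ge0// pospow_ge0.
apply: eq_integral => u _ /=.
rewrite /convpow -ge0_integralZl//.
- by apply: eq_integral => s _; rewrite -EFinM mulrC.
- exact: measurable_convpow_fun.
- by move=> x _; rewrite lee_fin mulr_ge0// pospow_ge0.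
Qed.

Lemma convpow_le0 p q u : u <= 0 -> convpow p q u = 0%E.
Proof.
move=> u0; apply: integral0_eq => s _.
have [s0|s0] := leP s 0; first by rewrite (pospow_le0 _ s0) mul0r.
by rewrite [X in _ * X]pospow_le0 ?mulr0// subr_le0 (le_trans u0)// ltW.
Qed.

Lemma pospowM p x u : 0 < u -> pospow p (u * x) = u `^ (p - 1) * pospow p x.
Proof.
move=> u0; rewrite /pospow pmulr_rgt0//; case: ifPn => [x0|]; last by rewrite mulr0.
by rewrite powRM// ltW.
Qed.

(** The substitution s = u x pulls out u * u^(p-1) * u^(q-1); for u <= 0 both sides vanish by
    truncation. *)
Lemma convpowE p q u :
  convpow p q u = ((pospow (p + q) u)%:E * convpow p q 1)%E.
Proof.
have [u0|u0] := leP u 0; first by rewrite convpow_le0// pospow_le0// mul0e.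
transitivity (u%:E * \int[mu]_x ((u `^ (p - 1) * u `^ (q - 1))%:E *
    (pospow p x * pospow q (1 - x))%:E))%E.
  have := @ge0_integral_affine u 0
    (fun s => (pospow p s * pospow q (u - s))%:E) u0 (@measurable_convpow_fun p q u).
  rewrite /convpow => ->; last by move=> x; rewrite lee_fin mulr_ge0// pospow_ge0.
  congr (_ * _)%E; apply: eq_integral => x _.
  by rewrite addr0 -{2}(mulr1 u) -mulrBr !pospowM// mulrACA EFinM.
rewrite ge0_integralZl//; last 3 first.
- exact: measurable_convpow_fun.
- by move=> x _; rewrite lee_fin mulr_ge0// pospow_ge0.
- by rewrite lee_fin mulr_ge0// powR_ge0.
rewrite muleA -EFinM pospow_gt0//; congr (_%:E * _)%E.
rewrite -powRD; last by rewrite (gt_eqF u0) implybT.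
rewrite -{1}(powRr1 (ltW u0)) -powRD; last by rewrite (gt_eqF u0) implybT.
congr (_ `^ _); ring.
Qed.

Lemma gammaeM_convpow p q : (gammae p * gammae q = gammae (p + q) * convpow p q 1)%E.
Proof.
rewrite gammaeM; set B := convpow p q 1.
have B0 : (0 <= B)%E by exact: convpow_ge0.
transitivity (\int[mu]_u ((pospow (p + q) u * expR (- u))%:E * B))%E.
  by apply: eq_integral => u _; rewrite (convpowE p q u) -/B muleA -EFinM mulrC.
rewrite ge0_integralZr//.
- exact: measurable_gammae_fun.
- by move=> x _; rewrite lee_fin mulr_ge0// ?expR_ge0// pospow_ge0.
Qed.

Lemma gammae1 : gammae 1 = 1%E.
Proof.
rewrite -(@integral_exponential_pdf R 1 ltr01) /gammae.
transitivity (\int[mu]_(t in `]0%R, +oo[) (expR (- t))%:E)%E.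
  rewrite [RHS]integral_mkcond; apply: eq_integral => t _.
  rewrite patchE /pospow subrr powRr0 mem_setE in_itv/= andbT.
  by case: ifP => _; rewrite ?mul1r ?mul0r.
rewrite integral_itv_obnd_cbnd; last first.
  apply/measurable_EFinP; apply: measurable_funTS.
  by apply: measurableT_comp => //.
rewrite [LHS]integral_mkcond; apply: eq_integral => t _.
by rewrite /exponential_pdf !patchE; case: ifPn => // _; rewrite mul1r mulN1r.
Qed.

(** The integrand x^(p-1) may be singular at 0, so the fundamental theorem is applied to x^p / p on
    [1/(n+2), 1[ and n tends to infinity by monotone convergence. *)
Lemma convpow_1 p : 0 < p -> convpow p 1 1 = p^-1%:E.
Proof.
move=> p0.
pose F n := `[(n.+2%:R^-1 : R), 1[%classic.
have nF : nondecreasing_seq F.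
  move=> m n mn; apply/subsetPset => x; rewrite /F/= !in_itv/= => /andP[h ->].
  by rewrite andbT (le_trans _ h)// lef_pV2 ?posrE// ler_nat !ltnS.
have UF : \bigcup_n F n = `]0 : R, 1[%classic.
  apply/seteqP; split => x /=.
    move=> [n _]; rewrite /F/= !in_itv/= => /andP[h ->].
    by rewrite andbT (lt_le_trans _ h)// invr_gt0.
  rewrite in_itv/= => /andP[x0 x1].
  exists (Num.truncn x^-1) => //; rewrite /F/= in_itv/= x1 andbT.
  rewrite invf_ple ?posrE//; apply: ltW.
  by rewrite (lt_trans (truncnS_gt _))// ltr_nat.
have mpw (A : set R) : measurable_fun A (fun x => (x `^ (p - 1))%:E).
  by apply/measurable_EFinP; apply: measurable_funTS; exact: measurable_powR.
have -> : convpow p 1 1 = (\int[mu]_(x in \bigcup_n F n) (x `^ (p - 1))%:E)%E.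
  rewrite UF [RHS]integral_mkcond; apply: eq_integral => x _.
  rewrite patchE /pospow subr_gt0 subrr powRr0.
  rewrite mem_setE in_itv/=.
  by case: (0 < x); case: (x < 1); rewrite ?mulr0 ?mul0r ?mulr1.
have FE n : (\int[mu]_(x in F n) (x `^ (p - 1))%:E)%E =
    (p^-1 - p^-1 * (n.+2%:R^-1) `^ p)%:E.
  have l0 : 0 < (n.+2%:R^-1 : R) by rewrite invr_gt0.
  rewrite integral_itv_bndo_bndc//.
  have dP x : 0 < x -> is_derive x 1 (fun x => p^-1 * x `^ p) (x `^ (p - 1)).
    move=> x0; apply: is_derive_eq; first by apply: is_deriveM; exact: is_derive1_powR.
    by rewrite scaler0 addr0 /GRing.scale/= mulrA mulVf ?mul1r// gt_eqF.
  have cP x : 0 < x -> {for x, continuous (fun x => p^-1 * x `^ p)}.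
    move=> x0; apply/differentiable_continuous/derivable1_diffP.
    by have [] := dP x x0.
  rewrite (@continuous_FTC2 _ _ (fun x => p^-1 * x `^ p)).
  - by rewrite powR1 mulr1 EFinB.
  - by rewrite invf_lt1// ltr1n.
  - apply: derivable_within_continuous => x; rewrite in_itv/= => /andP[x0 _].
    by apply: derivable_powR; rewrite in_itv/= andbT (lt_le_trans l0).
  - split.
    + move=> x; rewrite in_itv/= => /andP[x0 _].
      by have [] := dP x (lt_trans l0 x0).
    + by apply: cvg_at_right_filter; exact: (cP _ l0).
    + by apply: cvg_at_left_filter; exact: (cP 1 ltr01).
  - move=> x; rewrite in_itv/= => /andP[x0 _].
    by rewrite derive1E; have [_ ->] := dP x (lt_trans l0 x0).
have h : (\int[mu]_(x in F n) (x `^ (p - 1))%:E @[n --> \oo] -->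
    \int[mu]_(x in \bigcup_n F n) (x `^ (p - 1))%:E)%E.
  apply: ge0_nondecreasing_set_cvg_integral => //.
  - by move=> n; exact: measurable_itv.
  - by move=> n; exact: mpw.
  - by move=> n x Fx; rewrite lee_fin powR_ge0.
apply: (cvg_unique _ h) => //=.
under eq_fun do rewrite FE.
apply: cvg_EFin; first exact: nearW.
rewrite -[X in _ --> X]subr0; apply: cvgB; first exact: cvg_cst.
rewrite -(mulr0 p^-1); apply: cvgM; first exact: cvg_cst.
have /cvg_at_rightP := powR_cvg0 p0; apply.
split=> [n|]; first by rewrite invr_gt0.
by have := @cvg_harmonic R; rewrite -cvg_shiftS.
Qed.

(** The functional equation is the beta identity at q = 1, since B(p, 1) = 1/p; no integration by
    parts is involved. *)
Lemma gammaeS p : 0 < p -> (gammae p = p^-1%:E * gammae (p + 1))%E.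
Proof.
by move=> p0; rewrite -[LHS]mule1 -gammae1 gammaeM_convpow convpow_1// muleC.
Qed.

Lemma gammaeSn_lty n : (gammae n.+1%:R < +oo)%E.
Proof.
elim: n => [|n ih]; first by rewrite gammae1 ltry.
have := @gammaeS n.+1%:R (ltr0Sn _ _); rewrite natr1 => e.
move: ih; rewrite e; have := gammae_ge0 n.+2%:R.
by case: gammae => //= [r _ _|_]; rewrite ?ltry// gt0_muley ?ltxx// lte_fin invr_gt0.
Qed.

(** For p >= 1 and an integer n with p <= n + 1, t^(p-1) <= 1 + t^n reduces to integer arguments.
    The range 0 < p < 1 follows by the functional equation, read from p + 1 down to p. *)
Lemma gammae_lty p : 0 < p -> (gammae p < +oo)%E.
Proof.
have ge1 q : 1 <= q -> (gammae q < +oo)%E.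
  move=> q1; have [n qn] : exists n : nat, q <= n.+1%:R.
    by exists (Num.truncn q); exact/ltW/truncnS_gt.
  apply: (@le_lt_trans _ _ (gammae 1 + gammae n.+1%:R)%E); last first.
    by apply: lte_add_pinfty; [rewrite gammae1 ltry|exact: gammaeSn_lty].
  have e0 r t : (0%:E <= (pospow r t * expR (- t))%:E)%E.
    by rewrite lee_fin mulr_ge0// ?expR_ge0// pospow_ge0.
  have <- : (\int[mu]_t ((pospow 1 t * expR (- t))%:E +
      (pospow n.+1%:R t * expR (- t))%:E) = gammae 1 + gammae n.+1%:R)%E.
    by apply: ge0_integralD => //; exact: measurable_gammae_fun.
  apply: ge0_le_integral => //=.
  - exact: measurable_gammae_fun.
  - apply: emeasurable_funD; exact: measurable_gammae_fun.
  move=> t _; rewrite -EFinD lee_fin -mulrDl ler_wpM2r ?expR_ge0//.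
  have [t0|t0] := leP t 0; first by rewrite !pospow_le0 ?addr0.
  rewrite !pospow_gt0// subrr powRr0.
  have [t1|t1] := leP t 1.
    rewrite ler_wpDr ?powR_ge0// -[leRHS](powRr0 t) ger_powR ?t0// subr_ge0//.
  by rewrite ler_wpDl// ler_powR ?lerD2r// ltW.
move=> p0; have : (gammae (p + 1) < +oo)%E by apply: ge1; rewrite ler_wpDl// ltW.
rewrite (gammaeS p0); have := gammae_ge0 (p + 1).
by case: gammae => //= r _ _; rewrite -EFinM ltry.
Qed.

(** Only [M, M + 1] is kept, where the integrand is at least the stated product. As M is free, Gamma
    outgrows every geometric sequence, which makes the Mittag-Leffler series entire. *)
Lemma gammae_lb p M : 1 <= p -> 0 < M ->
  ((M `^ (p - 1) * expR (- (M + 1)))%:E <= gammae p)%E.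
Proof.
move=> p1 M0.
have -> : (M `^ (p - 1) * expR (- (M + 1)))%:E =
    (\int[mu]_(t in `[M, (M + 1)%R]) (cst (M `^ (p - 1) * expR (- (M + 1)))%:E t))%E.
  rewrite integral_cst//= lebesgue_measure_itv/= lte_fin ltrDl ltr01.
  by rewrite -EFinD addrAC subrr add0r mule1.
rewrite integral_mkcond; apply: ge0_le_integral => //=.
- move=> t _; rewrite patchE; case: ifPn => // _.
  by rewrite lee_fin mulr_ge0 ?expR_ge0 ?powR_ge0.
- apply/(measurable_restrictT _ _).1 => //.
- exact: measurable_gammae_fun.
move=> t _; rewrite patchE; case: ifPn => [|_]; last first.
  by rewrite lee_fin mulr_ge0 ?expR_ge0 ?pospow_ge0.
rewrite inE/= in_itv/= => /andP[Mt tM].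
rewrite lee_fin pospow_gt0 ?(lt_le_trans M0)// ler_pM ?expR_ge0 ?powR_ge0//.
  by rewrite ge0_ler_powR ?nnegrE ?subr_ge0// ?ltW// (lt_le_trans M0).
by rewrite ler_expR lerN2.
Qed.

Lemma gammaeE p : 0 < p -> gammae p = (Gamma p)%:E.
Proof.
move=> p0; rewrite GammaE fineK// ge0_fin_numE; first exact: gammae_lty.
exact: gammae_ge0.
Qed.

Lemma GammaS p : 0 < p -> Gamma (p + 1) = p * Gamma p.
Proof.
move=> p0; have := gammaeS p0.
rewrite (gammaeE p0) (@gammaeE (p + 1)) ?addr_gt0// -EFinM => -[->].
by rewrite mulrA mulfV ?mul1r// gt_eqF.
Qed.

Lemma Gamma_lb p M : 1 <= p -> 0 < M ->
  M `^ (p - 1) * expR (- (M + 1)) <= Gamma p.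
Proof.
by move=> p1 M0; rewrite -lee_fin -gammaeE ?gammae_lb// (lt_le_trans ltr01).
Qed.

Lemma Gamma_gt0 p : 0 < p -> 0 < Gamma p.
Proof.
move=> p0; rewrite -(pmulr_rgt0 _ p0) -GammaS//.
apply: lt_le_trans (@Gamma_lb (p + 1) 1 _ ltr01); last by rewrite ler_wpDl// ltW.
by rewrite powR1 mul1r expR_gt0.
Qed.

Lemma integral_pospow_conv p q u : 0 < p -> 0 < q ->
  (\int[mu]_s (pospow p s * pospow q (u - s))%:E)%E =
  (Gamma p * Gamma q / Gamma (p + q) * pospow (p + q) u)%:E.
Proof.
move=> p0 q0; have pq0 := addr_gt0 p0 q0.
rewrite -/(convpow p q u) convpowE EFinM muleC; congr (_ * _)%E.
have := gammaeM_convpow p q; rewrite !gammaeE//.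
(* The beta integral is finite: an infinite value would make the finite product of the two Gamma
   values infinite. *)
have := convpow_ge0 p q 1; case: convpow => [r _|_|//].
  rewrite -!EFinM => -[->]; rewrite mulrAC mulfV ?mul1r//.
  by rewrite gt_eqF// Gamma_gt0.
by rewrite gt0_muley// lte_fin Gamma_gt0.
Qed.

Lemma integrable_pospow_conv p q u : 0 < p -> 0 < q ->
  mu.-integrable [set: R] (fun s => (pospow p s * pospow q (u - s))%:E).
Proof.
move=> p0 q0; apply/integrableP; split; first exact: measurable_convpow_fun.
under eq_integral => s _.
  rewrite gee0_abs; last by rewrite lee_fin mulr_ge0// pospow_ge0.
  over.
by rewrite integral_pospow_conv// ltry.
Qed.

End euler_integrals.

(** * Entire power series and Mittag-Leffler functions *)

Section entire_series.
Context {R : realType}.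
Implicit Types (c : R^nat) (x z l q a b : R).

(** Infinite radius of convergence, stated as boundedness of the terms at every radius; this form
    passes easily to shifts and to multiplied coefficients. *)
Definition entire c :=
  forall M : R, 0 < M -> exists C, forall k, `|c k| * M ^+ k <= C.

Definition psum c z := limn (pseries c z).

(** The bound at radius 2|z| + 1 compares the terms at [z] with a geometric series of ratio 1/2; the
    added 1 keeps the radius positive when z = 0. *)
Lemma entire_normed_cvg c z : entire c -> cvgn (series (fun k => `|c k * z ^+ k|)).
Proof.
move=> ec; set M := 2 * `|z| + 1.
have M0 : 0 < M by rewrite ltr_wpDl// mulr_ge0.
have [C hC] := ec _ M0.
apply: (@series_le_cvg _ _ (geometric `|C| 2^-1)) => /=.
- by move=> n; exact: normr_ge0.
- by move=> n; rewrite mulr_ge0// exprn_ge0.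
- move=> n; apply: le_trans (_ : (`|c n| * M ^+ n) * 2^-1 ^+ n <= _); last first.
    by rewrite ler_wpM2r ?exprn_ge0// (le_trans (hC n))// ler_norm.
  rewrite normrM normrX -mulrA -exprMn ler_wpM2l// lerXn2r ?nnegrE ?mulr_ge0 ?(ltW M0)//.
  by rewrite /M mulrDl mulrC mulKf// lerDl.
- by apply: is_cvg_geometric_series; rewrite ger0_norm// invf_lt1// ltr1n.
Qed.

Lemma entire_cvg c z : entire c -> cvgn (pseries c z).
Proof. by move=> ec; apply: normed_cvg; exact: entire_normed_cvg. Qed.

Lemma cvg_psum c z : entire c -> pseries c z @ \oo --> psum c z.
Proof. exact: entire_cvg. Qed.

Lemma entire_shift c : entire c -> entire (fun k => c k.+1).
Proof.
move=> ec M M0; have [C hC] := ec M M0; exists (C / M) => k.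
by rewrite ler_pdivlMr// -mulrA -exprSr.
Qed.

(** The factor is at most (|q| + |a|) 2^k, which is absorbed by doubling the radius. Such factors
    are those produced by termwise differentiation. *)
Lemma entireM_affine c q a : entire c -> entire (fun k => (q + a * k%:R) * c k).
Proof.
move=> ec M M0; have M20 : 0 < 2 * M by rewrite mulr_gt0.
have [C hC] := ec _ M20; exists ((`|q| + `|a|) * C) => k.
apply: le_trans (_ : (`|q| + `|a|) * (`|c k| * (2 * M) ^+ k) <= _); last first.
  by rewrite ler_wpM2l ?addr_ge0.
have h : `|q + a * k%:R| <= (`|q| + `|a|) * 2 ^+ k.
  rewrite (le_trans (ler_normD _ _))// mulrDl lerD// ?normrM.
    by rewrite ler_peMr// exprn_ege1// ler1n.
  by rewrite ler_wpM2l// ger0_norm// -natrX ler_nat ltnW// ltn_expl.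
have -> : (`|q| + `|a|) * (`|c k| * (2 * M) ^+ k) =
    (`|q| + `|a|) * 2 ^+ k * `|c k| * M ^+ k by rewrite exprMn; ring.
by rewrite normrM ler_wpM2r ?exprn_ge0 ?(ltW M0)// ler_wpM2r.
Qed.

Lemma entireZ c l : entire c -> entire (fun k => l * c k).
Proof.
move=> /(@entireM_affine _ l 0); congr entire; apply/funext => k.
by rewrite mul0r addr0.
Qed.

Lemma entire_diffs c : entire c -> entire (pseries_diffs c).
Proof.
move=> ec; rewrite /pseries_diffs.
have := entire_shift (@entireM_affine _ 0 1 ec); congr entire.
by apply/funext => k; rewrite add0r mul1r.
Qed.

Lemma is_derive_psum c z : entire c ->
  is_derive z 1 (psum c) (psum (pseries_diffs c) z).
Proof.
move=> ec; apply: (@pseries_snd_diffs _ c (`|z| + 1)); try apply: entire_cvg.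
- by [].
- exact: entire_diffs.
- exact/entire_diffs/entire_diffs.
- by rewrite [ltRHS]ger0_norm ?addr_ge0// ltrDl.
Qed.

Lemma psum_shift c z : entire c -> psum c z = c 0%N + z * psum (fun k => c k.+1) z.
Proof.
move=> ec; have := @cvg_psum c z ec; rewrite -cvg_shiftS => h.
apply/esym; apply: (cvg_unique _ _ h) => //.
have -> : (fun n => pseries c z n.+1) =
    (fun n => c 0%N + z * pseries (fun k => c k.+1) z n).
  apply/funext => n; rewrite /pseries /series/= big_nat_recl// expr0 mulr1; congr (_ + _).
  by rewrite mulr_sumr; apply: eq_bigr => i _; rewrite exprS mulrCA.
apply: cvgD; first exact: cvg_cst.
apply: cvgM; first exact: cvg_cst.
exact/cvg_psum/entire_shift.
Qed.

Lemma psumZ c l z : entire c -> psum (fun k => l * c k) z = l * psum c z.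
Proof.
move=> ec; apply/esym; apply: (@cvg_unique _ _ (pseries (fun k => l * c k) z @ \oo)) => //.
  have -> : pseries (fun k => l * c k) z = (fun n => l * pseries c z n).
    apply/funext => n; rewrite /pseries /series/= mulr_sumr.
    by apply: eq_bigr => i _; rewrite mulrA.
  by apply: cvgM; [exact: cvg_cst|exact: cvg_psum].
exact/cvg_psum/entireZ.
Qed.

Lemma psumD c d z : entire c -> entire d ->
  psum (fun k => c k + d k) z = psum c z + psum d z.
Proof.
move=> ec ed.
have h : pseries (fun k => c k + d k) z @ \oo --> psum c z + psum d z.
  have -> : pseries (fun k => c k + d k) z = (fun n => pseries c z n + pseries d z n).
    apply/funext => n; rewrite /pseries /series/= -big_split/=.
    by apply: eq_bigr => i _; rewrite mulrDl.
  by apply: cvgD; exact: cvg_psum.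
exact: cvg_lim h.
Qed.

Lemma psum0 c : psum c 0 = c 0%N.
Proof.
apply: cvg_lim => //; rewrite -cvg_shiftS.
have -> : (fun n => pseries c 0 n.+1) = cst (c 0%N).
  apply/funext => n; rewrite /pseries /series/= big_nat_recl// expr0 mulr1 big1 ?addr0//.
  by move=> i _; rewrite exprS mul0r mulr0.
exact: cvg_cst.
Qed.

Lemma psum_gt0 c z : entire c -> (forall k, 0 <= c k) -> 0 < c 0%N -> 0 <= z ->
  0 < psum c z.
Proof.
move=> ec c0 c00 z0; rewrite psum_shift// ltr_wpDr// mulr_ge0//.
apply: limr_ge; first exact/entire_cvg/entire_shift.
by apply: nearW => n; apply: sumr_ge0 => i _; rewrite mulr_ge0// exprn_ge0.
Qed.

Lemma continuous_psum c : entire c -> continuous (psum c).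
Proof.
move=> ec z; apply/differentiable_continuous/derivable1_diffP.
by have [] := @is_derive_psum c z ec.
Qed.

(** The generalised series with terms c_k x^(q + a k), factored so that the sum is an ordinary power
    series in x^a. *)
Definition powser a q c x := x `^ q * psum c (x `^ a).

(** Termwise differentiation brings down the exponent q + a k. The q part comes from differentiating
    x^q; the a k part comes from the chain rule, after absorbing one factor x^a into the
    differentiated series. *)
Lemma is_derive_powser a q c x : entire c -> 0 < x ->
  is_derive x 1 (powser a q c) (powser a (q - 1) (fun k => (q + a * k%:R) * c k) x).
Proof.
move=> ec x0.
have d1 := is_derive1_powR q x0.
have d2 := is_derive1_powR a x0.
have d3 : is_derive x 1 (psum c \o (fun x => x `^ a))
    (psum (pseries_diffs c) (x `^ a) * (a * x `^ (a - 1))).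
  have d4 := @is_derive_psum c (x `^ a) ec.
  by have := @is_derive1_comp _ (psum c) (fun x => x `^ a) _ _ _ d4 d2; rewrite /GRing.scale/= mulrC.
have D := is_deriveM d1 d3.
rewrite -[powser a q c]/((fun x => x `^ q) * (psum c \o (fun x => x `^ a))).
apply: is_derive_eq D _.
rewrite /GRing.scale/= /powser.
have -> : x `^ q = x `^ (q - 1) * x.
  by rewrite -[X in _ = _ * X](powRr1 (ltW x0)) -powRD ?subrK// (gt_eqF x0) implybT.
have -> : psum (fun k => (q + a * k%:R) * c k) (x `^ a) =
    q * psum c (x `^ a) + a * (x `^ a * psum (pseries_diffs c) (x `^ a)).
  have -> : (fun k => (q + a * k%:R) * c k) =
      (fun k => q * c k + a * ((0 + 1 * k%:R) * c k)).
    by apply/funext => k; ring.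
  have e1 := @entireM_affine _ 0 1 ec.
  rewrite psumD ?psumZ//; last 2 first.
  - exact: entireZ.
  - exact: entireZ.
  rewrite (psum_shift _ e1) mulr0 addr0 mul0r add0r.
  have -> // : (fun k => (0 + 1 * k.+1%:R) * c k.+1) = pseries_diffs c.
  by apply/funext => k; rewrite add0r mul1r.
have -> : x `^ a = x * x `^ (a - 1).
  by rewrite -[X in _ = X * _](powRr1 (ltW x0)) -powRD 1?addrC ?subrK// (gt_eqF x0) implybT.
ring.
Qed.

Lemma continuous_powser a q c x : entire c -> 0 < x ->
  {for x, continuous (powser a q c)}.
Proof.
move=> ec x0; apply/differentiable_continuous/derivable1_diffP.
by have [] := @is_derive_powser a q c x ec x0.
Qed.

Lemma powser_shift a q c x : entire c -> c 0%N = 0 -> 0 < x ->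
  powser a q c x = powser a (q + a) (fun k => c k.+1) x.
Proof.
move=> ec c0 x0; rewrite /powser psum_shift// c0 add0r mulrA -powRD//.
by rewrite (gt_eqF x0) implybT.
Qed.

Lemma powserZ a q c l x : entire c ->
  powser a q (fun k => l * c k) x = l * powser a q c x.
Proof. by move=> ec; rewrite /powser psumZ// mulrCA. Qed.

(** The parameter [l] sits in the coefficients, so that E_{a,b}(l x^a) is a power series in x^a. *)
Definition ml_coef l a b (k : nat) : R := l ^+ k / Gamma (a * k%:R + b).

Lemma mittag_lefflerE l a b z : mittag_leffler a b (l * z) = psum (ml_coef l a b) z.
Proof.
rewrite /mittag_leffler /psum /pseries; congr (limn (series _)).
by apply/funext => k; rewrite /ml_coef exprMn mulrAC.
Qed.

(** With N = 1 + |l| M, the lower bound on Gamma at N gives N^z <= N exp(N + 1) Gamma(z) for z = a k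
    + b, while (|l| M)^k <= N^k <= N^z. The index 0 is separate because [b] may be below 1, where
    that bound does not apply. *)
Lemma entire_ml_coef l a b : 1 <= a -> 0 < b -> entire (ml_coef l a b).
Proof.
move=> a1 b0 M M0; set N := 1 + `|l| * M.
have N1 : 1 <= N by rewrite lerDl mulr_ge0// ltW.
have N0 : 0 < N by rewrite (lt_le_trans _ N1).
have E0 : 0 < N * expR (N + 1) by rewrite mulr_gt0// expR_gt0.
exists (N * expR (N + 1) + (Gamma b)^-1) => k.
case: k => [|k].
  rewrite expr0 mulr1 /ml_coef expr0 mul1r mulr0 add0r normfV gtr0_norm ?Gamma_gt0//.
  by rewrite lerDr ltW.
set z := a * k.+1%:R + b.
have k1 : 1 <= a * k.+1%:R by rewrite -[leLHS]mulr1 ler_pM// ler1n.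
have z1 : 1 <= z by rewrite ler_wpDr// ltW.
have z0 : 0 < z by exact: lt_le_trans z1.
have G0 := Gamma_gt0 z0.
rewrite ler_wpDr ?invr_ge0 ?(ltW (Gamma_gt0 b0))//.
rewrite /ml_coef normrM normfV normrX (gtr0_norm G0) mulrAC -exprMn ler_pdivrMr//.
apply: le_trans (_ : N * expR (N + 1) * (N `^ (z - 1) * expR (- (N + 1))) <= _); last first.
  by rewrite ler_wpM2l ?(ltW E0)// Gamma_lb.
have -> : N * expR (N + 1) * (N `^ (z - 1) * expR (- (N + 1))) = N `^ z.
  rewrite mulrACA mulr_powRB1 ?(ltW N0)// -expRD subrr expR0 mulr1//.
apply: le_trans (_ : N `^ (k.+1%:R) <= _); last first.
  by rewrite ler_powR// ler_wpDr ?(ltW b0)// ler_peMl.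
by rewrite powR_mulrn ?(ltW N0)// lerXn2r ?nnegrE ?mulr_ge0 ?(ltW M0) ?(ltW N0)// lerDr.
Qed.

End entire_series.

(** * Fractional integrals of power series *)

Section fractional_integral.
Context {R : realType}.
Implicit Types (a p q s u x : R) (c : R^nat).
Notation mu := (@lebesgue_measure R).

(** The series [powser] with leading exponent q - 1, truncated at 0 so that its fractional integrals
    run over the whole line. *)
Definition pser a q c s := pospow q s * psum c (s `^ a).

Lemma pser_powser a q c s : 0 < s -> pser a q c s = powser a (q - 1) c s.
Proof. by move=> s0; rewrite /pser pospow_gt0. Qed.

Lemma pser_le0 a q c s : s <= 0 -> pser a q c s = 0.
Proof. by move=> s0; rewrite /pser pospow_le0// mul0r. Qed.

Lemma measurable_pser a q c : entire c -> measurable_fun [set: R] (pser a q c).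
Proof.
move=> ec; apply: measurable_funM; first exact: measurable_pospow.
apply: measurableT_comp; last exact: measurable_powR.
by apply: continuous_measurable_fun; exact: continuous_psum.
Qed.

Lemma measurable_pospow_sub p x : measurable_fun [set: R] (fun s => pospow p (x - s)).
Proof.
apply: measurableT_comp; first exact: measurable_pospow.
exact: measurable_funB.
Qed.

Lemma pospow_exp a q s (k : nat) : pospow (a * k%:R + q) s = pospow q s * (s `^ a) ^+ k.
Proof.
rewrite /pospow; case: ifPn => [s0|]; last by rewrite mul0r.
rewrite -powR_mulrn ?powR_ge0// -powRrM -powRD; last by rewrite (gt_eqF s0) implybT.
by congr (_ `^ _); ring.
Qed.

Let fint_term a p q c x n s :=
  pospow q s * pseries c (s `^ a) n * pospow p (x - s).

Let fint_termE a p q c x n s : fint_term a p q c x n s =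
  \sum_(0 <= k < n) c k * (pospow (a * k%:R + q) s * pospow p (x - s)).
Proof.
rewrite /fint_term /pseries /series/= mulr_sumr mulr_suml.
by apply: eq_bigr => k _; rewrite pospow_exp; ring.
Qed.

(** The ratio of Gamma values is the beta value B(a k + q, p), produced by convolving s^(a k + q -
    1) with s^(p - 1). *)
Definition fint_coef a p q c (k : nat) :=
  Gamma (a * k%:R + q) * Gamma p / Gamma (a * k%:R + q + p) * c k.

Let integral_fint_term a p q c x n : 0 <= a -> 0 < p -> 0 < q -> 0 < x ->
  (\int[mu]_s (fint_term a p q c x n s)%:E)%E =
  (x `^ (q + p - 1) * pseries (fint_coef a p q c) (x `^ a) n)%:E.
Proof.
move=> a0 p0 q0 x0.
have kq (k : nat) : 0 < a * k%:R + q by rewrite ltr_wpDl// mulr_ge0.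
under eq_integral do rewrite fint_termE -sumEFin.
rewrite integral_sum//; last first.
  move=> k; under eq_fun do rewrite EFinM.
  by apply: integrableZl => //; exact: integrable_pospow_conv.
rewrite /pseries /series/= mulr_sumr -sumEFin; apply: eq_bigr => k _.
under eq_integral do rewrite EFinM.
rewrite integralZl//; last exact: integrable_pospow_conv.
rewrite integral_pospow_conv// -EFinM /fint_coef; congr EFin.
rewrite -addrA pospow_exp (pospow_gt0 _ x0).
move: (Gamma (a * k%:R + q)) (Gamma p) (Gamma (a * k%:R + (q + p))) => g1 g2 g3.
by ring.
Qed.

(** For 0 < s < x, monotonicity of s^a bounds every partial sum by the series of absolute values at
    x^a; elsewhere the truncated powers vanish. The resulting majorant is a multiple of a beta
    integrand. *)
Let fint_dominated a p q c x n s : entire c -> 0 <= a -> 0 < x ->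
  `|fint_term a p q c x n s| <=
  psum (fun k => `|c k|) (x `^ a) * (pospow q s * pospow p (x - s)).
Proof.
move=> ec a0 x0.
have [s0|s0] := leP s 0.
  by rewrite /fint_term (pospow_le0 _ s0) !mul0r normr0 mulr0.
have [xs|xs] := leP x s.
  by rewrite /fint_term (@pospow_le0 _ p (x - s)) ?subr_le0// !mulr0 normr0.
have -> : fint_term a p q c x n s =
  pseries c (s `^ a) n * (pospow q s * pospow p (x - s)).
  by rewrite /fint_term mulrAC mulrC.
have P0 : 0 <= pospow q s * pospow p (x - s) by rewrite mulr_ge0// pospow_ge0.
rewrite normrM [X in _ * X <= _]ger0_norm// ler_wpM2r//.
have ec' : entire (fun k => `|c k|).
  by move=> M M0; have [C hC] := ec M M0; exists C => k; rewrite normr_id.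
apply: (@le_trans _ _ (pseries (fun k => `|c k|) (x `^ a) n)).
  rewrite (le_trans (ler_norm_sum _ _ _))// ler_sum// => k _ /=.
  rewrite normrM ler_wpM2l// normrX lerXn2r ?nnegrE ?powR_ge0//.
  by rewrite ger0_norm ?powR_ge0// ge0_ler_powR ?nnegrE// ltW.
apply: nondecreasing_cvgn_le; last exact: entire_cvg.
by apply: nondecreasing_series => k _ _ /=; rewrite mulr_ge0// exprn_ge0// powR_ge0.
Qed.

Let fint_cvg a p q c x s : entire c ->
  fint_term a p q c x n s @[n --> \oo] --> pser a q c s * pospow p (x - s).
Proof.
move=> ec; apply: cvgM; last exact: cvg_cst.
by apply: cvgM; [exact: cvg_cst|exact: cvg_psum].
Qed.

Lemma integrable_pser a p q c x : entire c -> 0 <= a -> 0 < p -> 0 < q -> 0 < x ->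
  mu.-integrable [set: R] (fun s => (pser a q c s * pospow p (x - s))%:E).
Proof.
move=> ec a0 p0 q0 x0.
have i : mu.-integrable [set: R] (fun s => (psum (fun k => `|c k|) (x `^ a))%:E *
    (pospow q s * pospow p (x - s))%:E)%E.
  by apply: integrableZl => //; exact: integrable_pospow_conv.
apply: le_integrable i => //.
  apply/measurable_EFinP; apply: measurable_funM; first exact: measurable_pser.
  exact: measurable_pospow_sub.
move=> s _; rewrite -EFinM !abse_EFin lee_fin.
apply: le_trans (ler_norm _).
have hn : `|fint_term a p q c x n s| @[n --> \oo] -->
    `|pser a q c s * pospow p (x - s)| by apply: cvg_norm; exact: fint_cvg.
have <- := cvg_lim (@Rhausdorff R) hn.
apply: limr_le; first by apply/cvg_ex; eexists; exact: hn.
by apply: nearW => n; exact: fint_dominated.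
Qed.

(** Integration term by term, justified by dominated convergence. *)
Lemma Rintegral_pser a p q c x : entire c -> 0 <= a -> 0 < p -> 0 < q -> 0 < x ->
  (\int[mu]_s (pser a q c s * pospow p (x - s)))%R =
  powser a (q + p - 1) (fint_coef a p q c) x.
Proof.
move=> ec a0 p0 q0 x0.
have mterm n : measurable_fun [set: R] (fun s => (fint_term a p q c x n s)%:E).
  apply/measurable_EFinP; rewrite (_ : fint_term a p q c x n = fun s =>
    \sum_(0 <= k < n) c k * (pospow (a * k%:R + q) s * pospow p (x - s))); last first.
    by apply/funext => s; exact: fint_termE.
  apply: measurable_sum => k; apply: measurable_funM => //.
  by apply: measurable_funM; [exact: measurable_pospow|exact: measurable_pospow_sub].
have i : mu.-integrable [set: R] (fun s => (psum (fun k => `|c k|) (x `^ a))%:E *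
    (pospow q s * pospow p (x - s))%:E)%E.
  by apply: integrableZl => //; exact: integrable_pospow_conv.
have iF := integrable_pser ec a0 p0 q0 x0.
have h : (\int[mu]_s (fint_term a p q c x n s)%:E @[n --> \oo] -->
    \int[mu]_s (pser a q c s * pospow p (x - s))%:E)%E.
  apply: (dominated_cvg measurableT _ _ _ i) => //.
  - by move=> s _; apply: cvg_EFin; [exact: nearW|exact: fint_cvg].
  - by move=> n s _; rewrite -EFinM abse_EFin lee_fin; exact: fint_dominated.
have If := integrable_fin_num measurableT iF.
move: h; rewrite -(fineK If) => /fine_cvgP[_ h].
have X0 : x `^ (q + p - 1) != 0 by rewrite gt_eqF// powR_gt0.
(* Dividing by the nonzero power of [x] turns the convergence of the integrals into convergence of
   the series itself, whose limit is [psum] by definition. *)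
have h2 : pseries (fint_coef a p q c) (x `^ a) n @[n --> \oo] -->
    (x `^ (q + p - 1))^-1 * (\int[mu]_s (pser a q c s * pospow p (x - s)))%R.
  apply: cvg_trans (cvgM (cvg_cst (x `^ (q + p - 1))^-1) h).
  apply: near_eq_cvg; apply: nearW => n /=.
  by rewrite integral_fint_term//= mulKf.
rewrite /powser /psum (cvg_lim _ h2)// mulVKf//.
Qed.

End fractional_integral.

(** * Second differences at a double zero *)

Section mean_value.
Context {R : realType}.
Implicit Types (f df ddf : R -> R) (a b x y h : R).

Lemma mean_value f df a b : a < b ->
  (forall x, a <= x <= b -> is_derive x 1 f (df x)) ->
  exists2 c, a < c < b & f b - f a = df c * (b - a).
Proof.
move=> ab dF; have [||c cab e] := @MVT R f df a b ab.
- by move=> x; rewrite in_itv/= => /andP[ax xb]; apply: dF; rewrite !ltW.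
- apply: derivable_within_continuous => x; rewrite in_itv/= => /dF dfx.
  by have [] := dfx.
- by exists c => //; move: cab; rewrite in_itv.
Qed.

Lemma is_derive_shift1 f d x h : is_derive (x + h) 1 f d ->
  is_derive x 1 (fun z => f (z + h)) d.
Proof.
move=> df; have d1 : is_derive x 1 (fun z : R => z + h) 1.
  have D := is_deriveD (is_derive_id x (1 : R)) (is_derive_cst h x (1 : R)).
  by apply: is_derive_eq D _; rewrite addr0.
by have := @is_derive1_comp _ f (fun z => z + h) _ _ _ df d1; rewrite /GRing.scale/= ?mul1r ?mulr1.
Qed.

(** Two mean value steps: first for f(x + h) - f(x) on [y, y + h], then for [df] on an interval
    [z, z + h]. *)
Lemma second_difference f df ddf y h : 0 < h ->
  (forall x, y <= x <= y + 2 * h -> is_derive x 1 f (df x)) ->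
  (forall x, y <= x <= y + 2 * h -> is_derive x 1 df (ddf x)) ->
  exists2 z, y < z < y + 2 * h &
    f (y + 2 * h) - 2 * f (y + h) + f y = h ^+ 2 * ddf z.
Proof.
move=> h0 df1 df2.
have [||z /andP[yz zy] e1] :=
  @mean_value (fun x => f (x + h) - f x) (fun x => df (x + h) - df x) y (y + h).
- by rewrite ltrDl.
- move=> x /andP[yx xy]; apply: is_deriveB.
    by apply: is_derive_shift1; apply: df1; apply/andP; split; lra.
  by apply: df1; apply/andP; split; lra.
have [||x /andP[zx xz] e2] := @mean_value df ddf z (z + h).
- by rewrite ltrDl.
- by move=> x /andP[zx xz]; apply: df2; apply/andP; split; lra.
exists x; first by apply/andP; split; lra.
move: e1; rewrite e2 (_ : y + h + h = y + 2 * h); last by ring.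
move=> e1; transitivity (f (y + 2 * h) - f (y + h) - (f (y + h) - f y)); first by ring.
by rewrite e1; ring.
Qed.

End mean_value.

(** * Convexity of the kernel and the contradiction at a double zero *)

Section tangency.
Context {R : realType}.
Implicit Types (b t u v x y h : R).
Notation mu := (@lebesgue_measure R).

Lemma powR_le_nonpos r x y : r <= 0 -> 0 < x -> x <= y -> y `^ r <= x `^ r.
Proof.
move=> r0 x0 xy; rewrite -(opprK r) powRN [leRHS]powRN lef_pV2 ?posrE ?powR_gt0//.
  by rewrite ge0_ler_powR ?oppr_ge0// nnegrE ltW// (lt_le_trans x0).
by rewrite (lt_le_trans x0).
Qed.

(** Quantitative convexity of x^(b-1): its second derivative (1-b)(2-b) x^(b-3) does not increase,
    so over [y, y + 2h] it is smallest at the right end. *)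
Lemma second_difference_pospow b y h : b <= 1 -> 0 < y -> 0 < h ->
  h ^+ 2 * ((1 - b) * (2 - b) * (y + 2 * h) `^ (b - 3)) <=
  pospow b (y + 2 * h) - 2 * pospow b (y + h) + pospow b y.
Proof.
move=> b1 y0 h0.
have [||z /andP[yz zy]] := @second_difference _ (fun x => x `^ (b - 1))
  (fun x => (b - 1) * x `^ (b - 1 - 1))
  (fun x => (b - 1) * ((b - 1 - 1) * x `^ (b - 1 - 1 - 1))) y h h0.
- by move=> x /andP[yx _]; apply: is_derive1_powR; exact: lt_le_trans yx.
- move=> x /andP[yx _]; have x0 := lt_le_trans y0 yx.
  have D := is_deriveM (is_derive_cst (b - 1) x (1 : R)) (is_derive1_powR (b - 1 - 1) x0).
  by apply: is_derive_eq D _; rewrite scaler0 addr0.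
have yh : 0 < y + h by lra.
have y2h : 0 < y + 2 * h by lra.
rewrite (pospow_gt0 _ y0) (pospow_gt0 _ yh) (pospow_gt0 _ y2h) => ->; rewrite ler_wpM2l ?exprn_ge0 ?(ltW h0)//.
have -> : b - 1 - 1 - 1 = b - 3 by ring.
have -> : (b - 1) * ((b - 1 - 1) * z `^ (b - 3)) = (1 - b) * (2 - b) * z `^ (b - 3) by ring.
rewrite ler_wpM2l//; first by apply: mulr_ge0; lra.
by apply: powR_le_nonpos; [lra|exact: lt_trans yz|exact: ltW].
Qed.

(** The beta value B(1, b), the constant in the integral of (x - s)^(b-1) over s in [t, x]. *)
Let B b : R := Gamma 1 * Gamma b / Gamma (1 + b).

Lemma integral_pospow_conv_shift p q t x : 0 < p -> 0 < q ->
  (\int[mu]_s (pospow p (s - t) * pospow q (x - s))%:E)%E =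
  (Gamma p * Gamma q / Gamma (p + q) * pospow (p + q) (x - t))%:E.
Proof.
move=> p0 q0; rewrite -(integral_pospow_conv _ p0 q0).
rewrite (@ge0_integral_affine _ 1 t)//; last 2 first.
- apply/measurable_EFinP; apply: measurable_funM; last exact: measurable_pospow_sub.
  by apply: measurableT_comp; [exact: measurable_pospow|exact: measurable_funB].
- by move=> s; rewrite lee_fin mulr_ge0// pospow_ge0.
rewrite mul1e; apply: eq_integral => s _; congr (_ * _)%:E; congr pospow; ring.
Qed.

Lemma integrable_pospow_conv_shift p q t x : 0 < p -> 0 < q ->
  mu.-integrable [set: R] (fun s => (pospow p (s - t) * pospow q (x - s))%:E).
Proof.
move=> p0 q0; apply/integrableP; split.
  apply/measurable_EFinP; apply: measurable_funM; last exact: measurable_pospow_sub.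
  by apply: measurableT_comp; [exact: measurable_pospow|exact: measurable_funB].
under eq_integral => s _.
  rewrite gee0_abs; last by rewrite lee_fin mulr_ge0// pospow_ge0.
  over.
by rewrite integral_pospow_conv_shift// ltry.
Qed.

Let near_right (e h x z : R) : 0 < h -> h <= e / 4 -> x < z -> z < x + 2 * h ->
  `|x - z| < e.
Proof. by move=> h0 he xz zx; rewrite ltr_norml; apply/andP; split; lra. Qed.

Let double_lt (e h : R) : 0 < h -> h <= e / 4 -> 0 < 2 * h < e.
Proof. by move=> h0 he; apply/andP; split; lra. Qed.

Let final_ineq (m X Y Z : R) : 0 <= Y -> 16 * Y < m -> X <= Y -> Z < m ->
  2 * m - 4 * (Y + 2 * X) <= Z -> False.
Proof.
move=> Y0 h1 h2 h3 h4; have mm : m < m by lra.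
by move: mm; rewrite ltxx.
Qed.

Definition has_integral (f : R -> R) (l : R) :=
  mu.-integrable [set: R] (EFin \o f) /\ (\int[mu]_s f s)%R = l.

Lemma has_integralZ (f : R -> R) (r l : R) :
  has_integral f l -> has_integral (fun s => r * f s) (r * l).
Proof.
move=> [fi fl]; split; last by rewrite RintegralZl// fl.
exact: integrableZl fi.
Qed.

Lemma has_integralD (f g : R -> R) (l m : R) :
  has_integral f l -> has_integral g m -> has_integral (fun s => f s + g s) (l + m).
Proof.
move=> [fi fl] [gi gm]; split; last by rewrite RintegralD// fl gm.
exact: (integrableD measurableT fi gi).
Qed.

Lemma has_integralB (f g : R -> R) (l m : R) :
  has_integral f l -> has_integral g m -> has_integral (fun s => f s - g s) (l - m).
Proof.
move=> [fi fl] [gi gm]; split; last by rewrite RintegralB// fl gm.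
exact: (integrableB measurableT fi gi).
Qed.

Lemma has_integral_le (f g : R -> R) (l m : R) : (forall s, f s <= g s) ->
  has_integral f l -> has_integral g m -> l <= m.
Proof.
move=> fg [fi <-] [gi <-].
by apply: le_Rintegral => //.
Qed.

Lemma has_integral_indic u v : u <= v ->
  has_integral (\1_(`[u, v]%classic) : R -> R) (v - u).
Proof.
move=> uv; split; first exact: integrable_indic_itv.
rewrite /Rintegral integral_indic//= setIT lebesgue_measure_itv/= lte_fin.
by case: ltP => // vu; apply/eqP; rewrite eq_le subr_ge0 uv subr_le0 vu.
Qed.

Lemma has_integral_pospow_conv_shift p q t x : 0 < p -> 0 < q ->
  has_integral (fun s => pospow p (s - t) * pospow q (x - s))
    (Gamma p * Gamma q / Gamma (p + q) * pospow (p + q) (x - t)).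
Proof.
move=> p0 q0; split; first exact: integrable_pospow_conv_shift.
by rewrite /Rintegral integral_pospow_conv_shift.
Qed.

Variables (b t u v d C : R) (w : R -> R).
Hypothesis b01 : 0 < b < 1.
Hypothesis u0 : 0 < u.
Hypothesis uv : u < v.
Hypothesis vt : v < t.
Hypothesis d0 : 0 < d.
Hypothesis C0 : 0 <= C.
Hypothesis iw : forall x, 0 < x ->
  mu.-integrable [set: R] (fun s => (w s * pospow b (x - s))%:E).
Hypothesis w_le0 : forall s, s <= 0 -> w s = 0.
Hypothesis w_ge0 : forall s, 0 < s < t -> 0 <= w s.
Hypothesis w_ge : forall s, u <= s <= v -> d <= w s.
Hypothesis w_t : forall s, t <= s <= t + 2 -> `|w s| <= C * (s - t) ^+ 2.

Let W x : R := (\int[mu]_s (w s * pospow b (x - s)))%R.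
(** For h <= 1 and 0 < s < t one has t - s + 2h <= t + 2, so h^2 K bounds the second difference of
    the kernel from below, uniformly in s. *)
Let K : R := (1 - b) * (2 - b) * (t + 2) `^ (b - 3).

(** The integrands are compared pointwise. Left of [t], [w] is nonnegative and the kernel is convex,
    which gains d K h^2 on [u, v]. Right of [t] only s < t + 2h counts; there |w| <= 4 C h^2, and
    integrating the kernel costs one more factor of order h^b. *)
Lemma second_difference_lb h : 0 < h <= 1 ->
  h ^+ 2 * (d * K * (v - u) - 4 * C * B b * (pospow (1 + b) (2 * h) + 2 * pospow (1 + b) h))
  <= W (t + 2 * h) - 2 * W (t + h) + W t.
Proof.
move=> /andP[h0 h1]; have [b0 b1] := andP b01.
have t0 : 0 < t by rewrite (lt_trans u0)// (lt_trans uv).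
have K0 : 0 < K.
  by rewrite /K mulr_gt0 ?powR_gt0 ?mulr_gt0 ?subr_gt0 ?addr_gt0// (lt_trans b1)// ltr1n.
pose k x s : R := pospow b (x - s).
(* [pospow 1 (s - t)] is the indicator of s > t, in a form whose product with the kernel is a beta
   integrand. The constants 4 and 8 are the bound 4 C h^2 on |w| times the weights 1 and 2 of the
   second difference. *)
pose lo s : R := h ^+ 2 * (d * K) * \1_(`[u, v]%classic) s
  - 4 * C * h ^+ 2 * (pospow 1 (s - t) * k (t + 2 * h) s)
  - 8 * C * h ^+ 2 * (pospow 1 (s - t) * k (t + h) s).
pose hi s : R := w s * k (t + 2 * h) s - 2 * (w s * k (t + h) s) + w s * k t s.
have lohi s : lo s <= hi s.
  rewrite /lo /hi /k indicE mem_setE in_itv/=.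
  have [s0|s0] := leP s 0.
    rewrite w_le0// !mul0r mulr0 subrr addr0.
    have -> : pospow 1 (s - t) = 0 by rewrite pospow_le0//; lra.
    rewrite !mul0r !mulr0 !subr0.
    have -> : (u <= s <= v) = false by apply/negP => /andP[us _]; have := lt_le_trans u0 (le_trans us s0); rewrite ltxx.
    by rewrite !mulr0.
  have [st|st] := ltP s t.
    have -> : pospow 1 (s - t) = 0 by rewrite pospow_le0//; lra.
    rewrite !mul0r !mulr0 !subr0.
    have ws : 0 <= w s by apply: w_ge0; rewrite s0.
    have ts : 0 < t - s by rewrite subr_gt0.
    have := second_difference_pospow (ltW b1) ts h0.
    set X := pospow b (t - s + 2 * h) - _ + _ => hX.
    have hX2 : h ^+ 2 * K <= X.
      apply: le_trans hX; rewrite ler_wpM2l ?exprn_ge0 ?(ltW h0)// /K.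
      rewrite ler_wpM2l//; first by apply: mulr_ge0; lra.
      by apply: powR_le_nonpos; lra.
    have -> : w s * pospow b (t + 2 * h - s) - 2 * (w s * pospow b (t + h - s)) +
        w s * pospow b (t - s) = w s * X.
      rewrite /X (_ : t - s + 2 * h = t + 2 * h - s); last by ring.
      rewrite (_ : t - s + h = t + h - s); last by ring.
      by ring.
    have X0 : 0 <= X by apply: le_trans hX2; rewrite mulr_ge0 ?exprn_ge0 ?(ltW h0) ?(ltW K0).
    case: (boolP (u <= s <= v)) => [/w_ge dw|_]; last by rewrite mulr0 mulr_ge0.
    rewrite mulr1 mulrCA; apply: ler_pM => //; first exact: ltW.
    by rewrite mulr_ge0 ?exprn_ge0 ?(ltW h0) ?(ltW K0).
  have -> : (u <= s <= v) = false.
    by apply/negP => /andP[_ sv]; have := lt_le_trans vt (le_trans st sv); rewrite ltxx.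
  have -> : pospow b (t - s) = 0 by rewrite pospow_le0//; lra.
  rewrite !mulr0 addr0 sub0r.
  have [sh|sh] := leP (t + 2 * h) s.
    have -> : pospow b (t + 2 * h - s) = 0 by rewrite pospow_le0//; lra.
    have -> : pospow b (t + h - s) = 0 by rewrite pospow_le0//; lra.
    by rewrite !(mulr0, oppr0, addr0).
  have wC : `|w s| <= 4 * C * h ^+ 2.
    have wsC : `|w s| <= C * (s - t) ^+ 2 by apply: w_t; rewrite st/=; lra.
    apply: (le_trans wsC).
    rewrite (_ : 4 * C * h ^+ 2 = C * (2 * h) ^+ 2); last by ring.
    by rewrite ler_wpM2l// lerXn2r// ?nnegrE; lra.
  (* At s = t the truncated indicator is 0, so no correction term is available; the quadratic bound
     forces w(t) = 0 instead. *)
  have [-> |ts] := eqVneq s t.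
    have -> : w t = 0.
      apply/eqP; rewrite -normr_eq0 eq_le normr_ge0 andbT.
      by have := @w_t t; rewrite lexx lerDl ler0n subrr expr0n/= mulr0; exact.
    by rewrite subrr (pospow_le0 1 (lexx 0)) !(mul0r, mulr0, oppr0, addr0).
  have st' : 0 < s - t by rewrite subr_gt0 lt_neqAle eq_sym ts.
  rewrite (pospow_gt0 _ st') subrr powRr0 !mul1r.
  have := pospow_ge0 b (t + 2 * h - s); have := pospow_ge0 b (t + h - s).
  move: (pospow b (t + 2 * h - s)) (pospow b (t + h - s)) => P Q Q0 P0.
  move: wC; rewrite ler_norml => /andP[w1 w2].
  have h1' : - (4 * C * h ^+ 2) * P <= w s * P by rewrite ler_wpM2r.
  have h2' : w s * Q <= 4 * C * h ^+ 2 * Q by rewrite ler_wpM2r.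
  by lra.
have hiI : has_integral hi (W (t + 2 * h) - 2 * W (t + h) + W t).
  apply: has_integralD; last by split => //; exact: iw.
  apply: has_integralB; last apply: has_integralZ.
    by split => //; apply: iw; lra.
  by split => //; apply: iw; lra.
have loI : has_integral lo (h ^+ 2 * (d * K) * (v - u)
    - 4 * C * h ^+ 2 * (B b * pospow (1 + b) (t + 2 * h - t))
    - 8 * C * h ^+ 2 * (B b * pospow (1 + b) (t + h - t))).
  apply: has_integralB; last first.
    by apply: has_integralZ; exact: has_integral_pospow_conv_shift.
  apply: has_integralB; last first.
    by apply: has_integralZ; exact: has_integral_pospow_conv_shift.
  by apply: has_integralZ; apply: has_integral_indic; exact: ltW.
have := has_integral_le lohi loI hiI; apply: le_trans.
rewrite (_ : t + 2 * h - t = 2 * h); last by ring.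
rewrite (_ : t + h - t = h); last by ring.
by move: (B b) => Bb; rewrite le_eqVlt; apply/orP; left; apply/eqP; ring.
Qed.

(** The second difference of [V] at [t] is h^2 V''(z) with z between t and t + 2h. Continuity and
    V''(t) = 0 make it smaller than m h^2 for small h, against a lower bound h^2 (2m - O(h^b)). *)
Lemma tangency_absurd (V V' V'' : R -> R) :
  (forall x, 0 < x -> V x = (\int[mu]_s (w s * pospow b (x - s)))%R) ->
  (forall x, 0 < x -> is_derive x 1 V (V' x)) ->
  (forall x, 0 < x -> is_derive x 1 V' (V'' x)) ->
  {for t, continuous V''} -> V'' t = 0 -> False.
Proof.
move=> VE dV dV' cV V0; have [b0 b1] := andP b01.
have t0 : 0 < t by rewrite (lt_trans u0)// (lt_trans uv).
have K0 : 0 < K.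
  by rewrite /K mulr_gt0 ?powR_gt0 ?mulr_gt0 ?subr_gt0 ?addr_gt0// (lt_trans b1)// ltr1n.
(* [m] is half of the gain in the lower bound: one half absorbs the error terms, the other
   contradicts V'' < m. *)
have [m mE] : exists m, m = d * K * (v - u) / 2 by eexists.
have m0 : 0 < m by rewrite mE; apply: divr_gt0 => //; apply: mulr_gt0; [exact: mulr_gt0|rewrite subr_gt0].
have B0 : 0 < B b by rewrite /B divr_gt0 ?mulr_gt0 ?Gamma_gt0 ?addr_gt0.
have [e e0 eW] : exists2 e : R, 0 < e & forall x, `|t - x| < e -> `|V'' x| < m.
  move/cvgrPdist_lt/(_ _ m0) : cV => /nbhs_ballP[e/= e0 he]; exists e => // x tx.
  by have := he x tx; rewrite V0 sub0r normrN.
have [f f0 fW] : exists2 f : R, 0 < f & forall x, 0 < x < f -> 16 * C * B b * x `^ b < m.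
  have : 16 * C * B b * x `^ b @[x --> 0^'+] --> (0 : R).
    rewrite -[X in _ --> X](mulr0 (16 * C * B b)); apply: cvgM; first exact: cvg_cst.
    exact: powR_cvg0.
  move=> /cvgrPdist_lt/(_ _ m0)[f/= f0 hf]; exists f => // x /andP[x0 xf].
  have := hf x; rewrite /ball/= sub0r normrN gtr0_norm// => /(_ xf x0).
  by rewrite sub0r normrN; apply: le_lt_trans; exact: ler_norm.
(* The quarters make 2h strictly smaller than both thresholds. *)
have [h [h0 h1 he hf]] : exists h, [/\ 0 < h, h <= 1, h <= e / 4 & h <= f / 4].
  exists (Num.min 1 (Num.min (e / 4) (f / 4))).
  by rewrite !lt_min ltr01 !divr_gt0// !ge_min !lexx !orbT.
have [||z /andP[tz zt] ez] := @second_difference _ V V' V'' t h h0.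
- by move=> x /andP[tx _]; apply: dV; exact: lt_le_trans tx.
- by move=> x /andP[tx _]; apply: dV'; exact: lt_le_trans tx.
have := @second_difference_lb h; rewrite h0 h1 => /(_ isT).
rewrite /W -!VE ?ez ?addr_gt0 ?mulr_gt0//.
rewrite ler_pM2l ?exprn_gt0//.
have Wz : V'' z < m.
  by apply: le_lt_trans (ler_norm _) (eW z _); exact: near_right tz zt.
have p1 x : 0 < x -> pospow (1 + b) x = x `^ b.
  by move=> x0; rewrite pospow_gt0//; congr (_ `^ _); ring.
rewrite !p1 ?mulr_gt0//.
have hh : h <= 2 * h by rewrite ler_peMl ?(ltW h0)// ler1n.
have h2 : h `^ b <= (2 * h) `^ b.
  by rewrite ge0_ler_powR ?nnegrE ?(ltW b0)// ltW// mulr_gt0.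
have h3 : 16 * C * B b * (2 * h) `^ b < m.
  by apply: fW; exact: double_lt.
have h4 : C * B b * h `^ b <= C * B b * (2 * h) `^ b.
  by rewrite ler_wpM2l// mulr_ge0// ltW.
have -> : d * K * (v - u) = 2 * m by rewrite mE; field.
have -> : 4 * C * B b * ((2 * h) `^ b + 2 * h `^ b) =
    4 * (C * B b * (2 * h) `^ b + 2 * (C * B b * h `^ b)).
  by move: (B b) => Bb; ring.
have h3' : 16 * (C * B b * (2 * h) `^ b) < m by move: h3; rewrite -!mulrA.
apply: final_ineq h3' h4 Wz.
by apply: mulr_ge0; [apply: mulr_ge0 => //; exact: ltW|exact: powR_ge0].
Qed.

End tangency.

(** * Log-concavity *)

Section real_functions.
Context {R : realType}.
Implicit Types (f g df dg : R -> R) (x y t e : R).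

Lemma is_derive_div f g (df dg : R) x : f x != 0 ->
  is_derive x 1 f df -> is_derive x 1 g dg ->
  is_derive x 1 (fun y => g y / f y) ((dg * f x - g x * df) / f x ^+ 2).
Proof.
move=> fx0 hf hg.
have hV : is_derive x 1 (fun y => (f y)^-1) (- (f x) ^- 2 * df).
  by split; [apply: derivableV|rewrite deriveV//; case: hf => _ ->].
have D := is_deriveM hg hV; apply: is_derive_eq D _.
by rewrite /GRing.scale/=; field.
Qed.

(** The zero is the infimum of the points of ]0, y] where f <= 0; positivity on ]0, e[ keeps it away
    from 0. *)
Lemma first_zero f e y : 0 < e -> (forall x, 0 < x < e -> 0 < f x) ->
  (forall x, 0 < x -> {for x, continuous f}) -> 0 < y -> f y <= 0 ->
  exists t, [/\ 0 < t <= y, f t = 0 & forall s, 0 < s < t -> 0 < f s].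
Proof.
move=> e0 fe cf y0 fy.
pose S := [set x | 0 < x <= y /\ f x <= 0].
have Sy : S y by rewrite /S/= y0 lexx.
have eS x : S x -> e <= x.
  move=> [/andP[x0 _] fx]; rewrite leNgt; apply/negP => xe.
  by have := fe x; rewrite x0 xe => /(_ isT); rewrite ltNge fx.
have S0 : S !=set0 by exists y.
have lS : has_lbound S by exists e => x /eS.
set t := inf S.
have et : e <= t by apply: lb_le_inf => // x /eS.
have t0 : 0 < t by exact: lt_le_trans et.
have ty : t <= y by exact: ge_inf.
have ft s : 0 < s < t -> 0 < f s.
  move=> /andP[s0 st]; rewrite ltNge; apply/negP => fs.
  have : t <= s by apply: ge_inf => //; split => //; rewrite s0 (le_trans (ltW st)).
  by rewrite leNgt st.
exists t; split => //; first by rewrite t0.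
have near_t k : 0 < k -> exists2 r, 0 < r & forall x, `|t - x| < r -> `|f t - f x| < k.
  move=> k0; have := cf t t0; move/cvgrPdist_lt/(_ _ k0)/nbhs_ballP => [r/= r0 hr].
  by exists r => // x; exact: hr.
(* If f(t) > 0, continuity excludes points of [S] just right of t, against the infimum. If f(t) < 0,
   [f] is negative at points just left of t, where it is known to be positive. *)
apply/eqP; rewrite eq_le; apply/andP; split; rewrite leNgt; apply/negP => ft0.
  have [r r0 hr] := near_t _ ft0.
  have [x Sx xt] := inf_adherent r0 (conj S0 lS).
  have tx : t <= x by exact: ge_inf.
  have : `|f t - f x| < f t.
    by apply: hr; rewrite ler0_norm ?subr_le0// opprB ltrBlDr addrC.
  move=> /(le_lt_trans (ler_norm _)); rewrite ltrBlDr -ltrBlDl subrr.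
  by case: Sx => _ fx; rewrite ltNge fx.
have nf0 : 0 < - f t by rewrite oppr_gt0.
have [r r0 hr] := near_t _ nf0.
pose x := t - Num.min (t / 2) (r / 2).
have m0 : 0 < Num.min (t / 2) (r / 2) by rewrite lt_min !divr_gt0.
have x0 : 0 < x.
  have : Num.min (t / 2) (r / 2) <= t / 2 by rewrite ge_min lexx.
  by rewrite /x; lra.
have xt : x < t by rewrite /x; lra.
have : `|f t - f x| < - f t.
  apply: hr; rewrite /x opprB addrC subrK gtr0_norm//.
  have : Num.min (t / 2) (r / 2) <= r / 2 by rewrite ge_min lexx orbT.
  by lra.
have := ft x; rewrite x0 xt => /(_ isT) fx.
move=> H; have : f x < 0.
  by move: H; rewrite distrC => /(le_lt_trans (ler_norm _)); lra.
by rewrite ltNge (ltW fx).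
Qed.

(** A second-order Taylor bound by two mean value steps, with C the maximum of |f2| on the
    interval. *)
Lemma quadratic_contact f (f1 f2 : R -> R) t c : 0 <= c ->
  (forall x, t <= x <= t + c -> is_derive x 1 f (f1 x)) ->
  (forall x, t <= x <= t + c -> is_derive x 1 f1 (f2 x)) ->
  (forall x, t <= x <= t + c -> {for x, continuous f2}) ->
  f t = 0 -> f1 t = 0 ->
  exists2 C : R, 0 <= C & forall s, t <= s <= t + c -> `|f s| <= C * (s - t) ^+ 2.
Proof.
move=> c0 df df1 cf2 ft f1t.
have tc : t <= t + c by rewrite lerDl.
have [|z _ hz] := @EVT_max R (fun s => `|f2 s|) _ _ tc.
  apply: continuous_in_subspaceT => s; rewrite inE/= in_itv/= => ts.
  by apply: cvg_norm; exact: cf2.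
exists `|f2 z| => // s /andP[ts st].
move: ts; rewrite le_eqVlt => /predU1P[<-|ts].
  by rewrite ft normr0 mulr_ge0// sqr_ge0.
have [|x /andP[tx xs]] := @mean_value _ f f1 t s ts.
  by move=> x /andP[tx xs]; apply: df; rewrite tx (le_trans xs).
rewrite ft subr0 => ->.
have [|y /andP[ty yx]] := @mean_value _ f1 f2 t x tx.
  by move=> y /andP[ty yx]; apply: df1; rewrite ty (le_trans yx)// (le_trans (ltW xs)).
rewrite f1t subr0 => ->; rewrite !normrM -mulrA expr2; apply: ler_pM => //.
  by apply: hz; rewrite in_itv/= ltW//= (le_trans (ltW yx))// (le_trans (ltW xs)).
by rewrite !gtr0_norm ?subr_gt0// ler_pM2r ?subr_gt0// lerD2r ltW.
Qed.

Lemma positive_lower_bound f x y : x <= y ->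
  (forall s, x <= s <= y -> {for s, continuous f}) ->
  (forall s, x <= s <= y -> 0 < f s) ->
  exists2 d : R, 0 < d & forall s, x <= s <= y -> d <= f s.
Proof.
move=> xy cf f0; have [|z zxy hz] := @EVT_min R f _ _ xy.
  by apply: continuous_in_subspaceT => s; rewrite inE/= in_itv/= => /cf.
exists (f z); first by apply: f0; move: zxy; rewrite in_itv.
by move=> s sxy; apply: hz; rewrite in_itv.
Qed.

Lemma derive0_cst f x y : x < y ->
  (forall z, x <= z <= y -> is_derive z 1 f 0) -> f y = f x.
Proof.
move=> xy df; have [z _ /eqP] := @mean_value _ f (cst 0) x y xy df.
by rewrite mul0r subr_eq0 => /eqP.
Qed.

(** Nothing is assumed at 0, so the mean value theorem starts from e/2, where positivity is
    given. *)
Lemma increasing_gt0 f (f1 : R -> R) e x : 0 < e ->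
  (forall y, 0 < y < e -> 0 < f y) ->
  (forall y, 0 < y <= x -> is_derive y 1 f (f1 y)) ->
  (forall y, 0 < y <= x -> 0 < f1 y) -> 0 < x -> 0 < f x.
Proof.
move=> e0 fe df f10 x0; have [xe|ex] := ltP x e; first by apply: fe; rewrite x0.
have e20 : 0 < e / 2 by rewrite divr_gt0.
have ee : e / 2 < e by lra.
have ex2 : e / 2 < x by exact: lt_le_trans ex.
have df' y : e / 2 <= y <= x -> is_derive y 1 f (f1 y).
  by move=> /andP[ey yx]; apply: df; rewrite yx (lt_le_trans e20).
have [z /andP[ez zx] h] := mean_value ex2 df'.
have fe2 : 0 < f (e / 2) by apply: fe; rewrite e20.
rewrite -(subrK (f (e / 2)) (f x)) h addr_gt0// mulr_gt0 ?subr_gt0//.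
by apply: f10; rewrite (lt_trans e20)//= ltW.
Qed.

(* Since f1 / f decreases, f(x)/f(x-s) decreases in x, and
   f1(1)/f(1) < f1(1-s)/f(1-s); multiply the two inequalities. *)
Lemma logconcave_cross f (f1 : R -> R) s t :
  (forall x, 0 < x <= 1 -> 0 < f x) ->
  (forall x, 0 < x <= 1 -> is_derive x 1 f (f1 x)) ->
  (forall x y, 0 < x -> x < y -> y <= 1 -> f1 y / f y < f1 x / f x) ->
  0 < f1 1 -> 0 < s -> s < t -> t < 1 ->
  f (t - s) * f1 1 < f t * f1 (1 - s).
Proof.
move=> f0 df ratio f1p s0 st t1.
have dphi x : t <= x <= 1 -> is_derive x 1 (fun x => f x / f (x - s))
    ((f1 x * f (x - s) - f x * f1 (x - s)) / f (x - s) ^+ 2).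
  move=> /andP[tx x1].
  have xs : 0 < x - s <= 1 by apply/andP; split; lra.
  have x01 : 0 < x <= 1 by apply/andP; split; lra.
  apply: (@is_derive_div (fun x => f (x - s)) f).
  - by rewrite gt_eqF// f0.
  - by apply: is_derive_shift1; exact: df.
  - exact: df.
have [x /andP[tx x1] e] := mean_value t1 dphi.
have xs : 0 < x - s by lra.
have fxs : 0 < f (x - s) by apply: f0; apply/andP; split; lra.
have fx : 0 < f x by apply: f0; apply/andP; split; lra.
have fts : 0 < f (t - s) by apply: f0; apply/andP; split; lra.
have f1s : 0 < f (1 - s) by apply: f0; apply/andP; split; lra.
have ft : 0 < f t by apply: f0; apply/andP; split; lra.
have f11 : 0 < f 1 by apply: f0; rewrite ltr01 lexx.
have h1 : f 1 / f (1 - s) < f t / f (t - s).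
  rewrite -subr_lt0 e pmulr_llt0 ?subr_gt0// pmulr_llt0 ?invr_gt0 ?exprn_gt0//.
  have := @ratio (x - s) x xs _ (ltW x1); rewrite ltrBlDr ltrDl => /(_ s0).
  by rewrite ltr_pdivrMr// mulrAC ltr_pdivlMr// subr_lt0 (mulrC (f x)).
have h2 : f1 1 / f 1 < f1 (1 - s) / f (1 - s) by apply: ratio; lra.
rewrite ltr_pdivrMr// mulrAC ltr_pdivlMr// in h1.
rewrite ltr_pdivrMr// mulrAC ltr_pdivlMr// in h2.
rewrite -(ltr_pM2r (mulr_gt0 f11 f1s)).
have := ltr_pM (ltW (mulr_gt0 f11 fts)) (ltW (mulr_gt0 f1p f1s)) h1 h2.
by congr (is_true (_ < _)); ring.
Qed.

End real_functions.

Local Opaque Gamma psum powR.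

(** * The function f, its derivatives, and positivity of f'^2 - f f'' *)

Section kernel.
Context {R : realType}.
Variables (a l : R).
Hypothesis a12 : 1 < a <= 2.
Implicit Types (b v x y s t : R) (c : R^nat).

Let a1 : 1 < a. Proof. by case/andP: a12. Qed.
Let a2 : a <= 2. Proof. by case/andP: a12. Qed.
Let a0 : 0 < a. Proof. exact: lt_trans a1. Qed.
Let a10 : 0 < a - 1. Proof. by rewrite subr_gt0. Qed.

(** This is Gamma(z + 1) = z Gamma(z). In series form, differentiating x^b E_{a,b+1}(l x^a) yields
    x^(b-1) E_{a,b}(l x^a). *)
Lemma ml_coef_rec b k : 0 < b + a * k%:R ->
  (b + a * k%:R) * ml_coef l a (b + 1) k = ml_coef l a b k.
Proof.
move=> bk; rewrite /ml_coef addrA (addrC _ b) GammaS//.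
by field; rewrite !gt_eqF ?Gamma_gt0.
Qed.

Lemma ml_coefS b k : ml_coef l a b k.+1 = l * ml_coef l a (b + a) k.
Proof.
rewrite /ml_coef exprS mulrA; congr (_ / Gamma _).
by rewrite -natr1; ring.
Qed.

(** The second and third derivatives keep explicit exponent factors: [ml_coef l a (a - 2)] would
    evaluate Euler's integral at a - 2 <= 0, where it does not represent Gamma. *)
Let c0 := ml_coef l a a.
Let c1 := ml_coef l a (a - 1).
Let c2 k := (a - 2 + a * k%:R) * c1 k.
Let c3 k := (a - 3 + a * k%:R) * c2 k.

Let ec0 : entire c0. Proof. by apply: entire_ml_coef => //; exact: ltW. Qed.
Let ec1 : entire c1. Proof. by apply: entire_ml_coef => //; exact: ltW. Qed.
Let ec2 : entire c2. Proof. exact: entireM_affine. Qed.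
Let ec3 : entire c3. Proof. exact: entireM_affine. Qed.

Definition ml_fun x : R := powser a (a - 1) c0 x.
Definition ml_fun1 x : R := powser a (a - 2) c1 x.
Definition ml_fun2 x : R := powser a (a - 3) c2 x.
Definition ml_fun3 x : R := powser a (a - 4) c3 x.

Local Notation f := ml_fun.
Local Notation f1 := ml_fun1.
Local Notation f2 := ml_fun2.
Local Notation f3 := ml_fun3.

Lemma is_derive_ml_fun x : 0 < x -> is_derive x 1 f (f1 x).
Proof.
move=> x0; have := @is_derive_powser _ a (a - 1) c0 x ec0 x0.
have -> : (fun k => (a - 1 + a * k%:R) * c0 k) = c1.
  apply/funext => k; have := @ml_coef_rec (a - 1) k; rewrite subrK; apply.
  by rewrite ltr_wpDr// mulr_ge0// ltW.
by rewrite (_ : a - 1 - 1 = a - 2) //; ring.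
Qed.

Lemma is_derive_ml_fun1 x : 0 < x -> is_derive x 1 f1 (f2 x).
Proof.
move=> x0; have := @is_derive_powser _ a (a - 2) c1 x ec1 x0.
by rewrite (_ : a - 2 - 1 = a - 3) //; ring.
Qed.

Lemma is_derive_ml_fun2 x : 0 < x -> is_derive x 1 f2 (f3 x).
Proof.
move=> x0; have := @is_derive_powser _ a (a - 3) c2 x ec2 x0.
by rewrite (_ : a - 3 - 1 = a - 4) //; ring.
Qed.

(** The Wronskian of f' and f, equal to -f^2 (f'/f)' wherever f is nonzero. *)
Definition wronskian x : R := f1 x ^+ 2 - f x * f2 x.
Local Notation q := wronskian.

Lemma cvg_psum_powR0 c : entire c -> psum c (x `^ a) @[x --> 0^'+] --> c 0%N.
Proof.
move=> ec; rewrite -(psum0 c).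
apply: (@cvg_comp _ _ _ (fun x => x `^ a) (psum c) _ (nbhs (0 : R))).
  exact: powR_cvg0.
exact: (continuous_psum ec).
Qed.

Lemma near0_gt0 (g : R -> R) v : g x @[x --> 0^'+] --> v -> 0 < v ->
  exists2 e : R, 0 < e & forall x, 0 < x < e -> 0 < g x.
Proof.
move=> gv v0; move/cvgrPdist_lt/(_ _ v0) : gv => [e/= e0 he]; exists e => // x /andP[x0 xe].
have := he x; rewrite /ball/= sub0r normrN gtr0_norm// => /(_ xe x0).
by move=> /(le_lt_trans (ler_norm _)); rewrite ltrBlDr -ltrBlDl subrr.
Qed.

Lemma ml_fun_gt0_near0 : exists2 e : R, 0 < e & forall x, 0 < x < e -> 0 < f x.
Proof.
have c00 : 0 < c0 0%N by rewrite /c0 /ml_coef mulr0 add0r expr0 mul1r invr_gt0 Gamma_gt0.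
have [e e0 he] := near0_gt0 (cvg_psum_powR0 ec0) c00.
exists e => // x xe; rewrite /ml_fun /powser mulr_gt0// ?he//.
by rewrite powR_gt0//; case/andP: xe.
Qed.

(** After factoring out x^(2(a-2)), the limit at 0 is c1(0)^2 - c0(0) c2(0), which is positive
    because c2(0) = (a-2) c1(0) <= 0. *)
Lemma wronskian_gt0_near0 : exists2 e : R, 0 < e & forall x, 0 < x < e -> 0 < q x.
Proof.
have c10 : 0 < c1 0%N by rewrite /c1 /ml_coef mulr0 add0r expr0 mul1r invr_gt0 Gamma_gt0.
have c00 : 0 < c0 0%N by rewrite /c0 /ml_coef mulr0 add0r expr0 mul1r invr_gt0 Gamma_gt0.
have h : psum c1 (x `^ a) ^+ 2 - psum c0 (x `^ a) * psum c2 (x `^ a) @[x --> 0^'+] -->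
    c1 0%N ^+ 2 - c0 0%N * c2 0%N.
  apply: cvgB; last by apply: cvgM; exact: cvg_psum_powR0.
  by rewrite !expr2; apply: cvgM; exact: cvg_psum_powR0.
have v0 : 0 < c1 0%N ^+ 2 - c0 0%N * c2 0%N.
  have -> : c2 0%N = (a - 2) * c1 0%N by rewrite /c2 mulr0 addr0.
  move: (c0 0%N) (c1 0%N) c00 c10 => y z y0 z0.
  rewrite subr_gt0; apply: (@le_lt_trans _ _ 0); last exact: exprn_gt0.
  apply: mulr_ge0_le0; first exact: ltW.
  by apply: mulr_le0_ge0; [rewrite subr_le0|exact: ltW].
have [e e0 he] := near0_gt0 h v0.
exists e => // x xe; have /andP[x0 _] := xe.
have -> : q x = x `^ (a - 2) ^+ 2 *
    (psum c1 (x `^ a) ^+ 2 - psum c0 (x `^ a) * psum c2 (x `^ a)).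
  rewrite /wronskian /ml_fun /ml_fun1 /ml_fun2 /powser.
  have e1 : x `^ (a - 1) = x `^ (a - 2) * x.
    rewrite -[X in _ = _ * X](powRr1 (ltW x0)) -powRD ?(gt_eqF x0) ?implybT//.
    by congr (_ `^ _); ring.
  have e2 : x * x `^ (a - 3) = x `^ (a - 2).
    rewrite -[X in X * _ = _](powRr1 (ltW x0)) -powRD ?(gt_eqF x0) ?implybT//.
    by congr (_ `^ _); ring.
  rewrite e1 -e2; generalize (psum c0 (x `^ a)) (psum c1 (x `^ a)) (psum c2 (x `^ a)).
  by generalize (x `^ (a - 3)) => *; ring.
by rewrite mulr_gt0 ?he// exprn_gt0// powR_gt0.
Qed.

Lemma continuous_wronskian x : 0 < x -> {for x, continuous q}.
Proof.
move=> x0.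
have k0 : {for x, continuous f} by exact: continuous_powser.
have k1 : {for x, continuous f1} by exact: continuous_powser.
have k2 : {for x, continuous f2} by exact: continuous_powser.
exact: (cvgB (cvgM k1 k1) (cvgM k0 k2)).
Qed.

Lemma ratio_decr x y : 0 < x -> x < y ->
  (forall z, x <= z <= y -> 0 < f z) -> (forall z, x < z < y -> 0 < q z) ->
  f1 y / f y < f1 x / f x.
Proof.
move=> x0 xy fz qz.
have [//||c cxy e] := @mean_value R (fun z => f1 z / f z)
  (fun z => (f2 z * f z - f1 z * f1 z) / f z ^+ 2) x y.
  move=> z xzy; have z0 : 0 < z by case/andP: xzy => xz _; exact: lt_le_trans xz.
  apply: is_derive_div.
  - by rewrite gt_eqF// fz.
  - exact: is_derive_ml_fun.
  - exact: is_derive_ml_fun1.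
rewrite -subr_lt0 e pmulr_llt0 ?subr_gt0//.
have := qz c cxy; rewrite /wronskian => qc.
rewrite pmulr_llt0 ?invr_gt0 ?exprn_gt0 ?fz//; last by case/andP: cxy => *; rewrite !ltW.
move: qc; generalize (f c) (f1 c) (f2 c) => A B C; rewrite -oppr_lt0.
by congr (is_true (_ < 0)); ring.
Qed.

Lemma ml_fun_pser x : 0 < x -> f x = pser a a c0 x.
Proof. by move=> x0; rewrite pser_powser. Qed.

Lemma ml_fun1_pser x : 0 < x -> f1 x = pser a (a - 1) c1 x.
Proof. by move=> x0; rewrite pser_powser// (_ : a - 1 - 1 = a - 2)//; ring. Qed.

Lemma continuous_ml_fun2 x : 0 < x -> {for x, continuous f2}.
Proof. exact: continuous_powser. Qed.

Lemma continuous_ml_fun3 x : 0 < x -> {for x, continuous f3}.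
Proof. exact: continuous_powser. Qed.

(** The unsimplified parameters match the right side of [powser_ml_second] at p = 1; those of
    [ml_fun1E] match it at p = 0. *)
Lemma ml_funE x : f x = powser a (1 - 1 - 1 + a) (ml_coef l a (1 - 1 + a)) x.
Proof.
by rewrite /ml_fun /c0; congr (powser _ _ (ml_coef _ _ _) _); ring.
Qed.

Lemma ml_fun1E x : f1 x = powser a (0 - 1 - 1 + a) (ml_coef l a (0 - 1 + a)) x.
Proof.
by rewrite /ml_fun1 /c1; congr (powser _ _ (ml_coef _ _ _) _); ring.
Qed.

(** The left side is the second derivative of x^p E_{a,p+1}(l x^a). For p = 0 or p = 1 the leading
    term dies, and shifting the index brings out the factor [l]. *)
Lemma powser_ml_second p x : 0 <= p -> p * (p - 1) = 0 -> 0 < x ->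
  powser a (p - 1 - 1)
    (fun k => (p - 1 + a * k%:R) * ((p + a * k%:R) * ml_coef l a (p + 1) k)) x =
  l * powser a (p - 1 - 1 + a) (ml_coef l a (p - 1 + a)) x.
Proof.
move=> p0 pp x0.
have ak (k : nat) : 1 < a * k.+1%:R.
  by rewrite (lt_le_trans a1)// ler_peMr ?(ltW a0)// ler1n.
have ep : entire (ml_coef l a (p + 1)).
  by apply: entire_ml_coef; [exact: ltW|rewrite ltr_wpDl].
have ep' : entire (ml_coef l a (p - 1 + a)).
  apply: entire_ml_coef; first exact: ltW.
  by rewrite -addrA ltr_wpDl// addrC.
set c := fun k => _.
have ec : entire c by exact/entireM_affine/entireM_affine.
have cz : c 0%N = 0 by rewrite /c !mulr0 !addr0 mulrA (mulrC (p - 1)) pp mul0r.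
rewrite (powser_shift a _ ec cz x0) -(powserZ _ _ _ _ ep') /c.
congr (powser _ _ _ _); apply/funext => k; have akk := ak k.
rewrite ml_coef_rec; last by lra.
have := @ml_coef_rec (p - 1) k.+1; rewrite subrK => ->; last by lra.
exact: ml_coefS.
Qed.

(** The beta factor cancels Gamma(a k + q) in the coefficient, so fractional integration of order p
    raises the second Mittag-Leffler parameter from q to q + p. *)
Lemma has_integral_pser_ml p q x b : 0 < p -> 0 < q -> 0 < x -> b = q + p ->
  has_integral (fun s => pser a q (ml_coef l a q) s * pospow p (x - s))
    (Gamma p * powser a (b - 1) (ml_coef l a b) x).
Proof.
move=> p0 q0 x0 ->.
have eq : entire (ml_coef l a q) by apply: entire_ml_coef => //; exact: ltW.
have eqp : entire (ml_coef l a (q + p)).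
  by apply: entire_ml_coef; [exact: ltW|exact: addr_gt0].
split; first exact: integrable_pser eq (ltW a0) p0 q0 x0.
have cE : fint_coef a p q (ml_coef l a q) = fun k => Gamma p * ml_coef l a (q + p) k.
  apply/funext => k; rewrite /fint_coef /ml_coef.
  have kq : 0 < a * k%:R + q by rewrite ltr_wpDl// mulr_ge0// ltW.
  have cancel (y z t g : R) : y != 0 -> y * g / z * (t / y) = g * (t / z).
    by move=> y0; generalize z^-1 => u; field.
  by rewrite -addrA; apply: cancel; rewrite gt_eqF// Gamma_gt0.
by rewrite (Rintegral_pser eq (ltW a0) p0 q0 x0) cE powserZ.
Qed.

(** At a = 2 the leading coefficient (a-2) c1(0) vanishes; after the index shift the series of f''
    is [l] times that of f. *)
Lemma ml_fun2_eq2 x : a = 2 -> 0 < x -> f2 x = l * f x.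
Proof.
move=> a_2 x0.
have c20 : c2 0%N = 0 by rewrite /c2 a_2 subrr mulr0 addr0 mul0r.
have cE : (fun k => c2 k.+1) = fun k => l * c0 k.
  apply/funext => k; rewrite /c2 /c1.
  have e1 : a - 2 + 1 = a - 1 by ring.
  have e2 : a - 2 + a = a by rewrite {1}a_2 subrr add0r.
  have := @ml_coef_rec (a - 2) k.+1; rewrite e1 => ->; first by rewrite ml_coefS e2.
  by rewrite {1}a_2 subrr add0r mulr_gt0.
rewrite /ml_fun2 (powser_shift a (a - 3) ec2 c20 x0) cE (powserZ _ _ _ _ ec0).
have -> // : a - 3 + a = a - 1.
by rewrite a_2; ring.
Qed.

Lemma ml_fun_0 : f 0 = 0.
Proof. by rewrite /ml_fun /powser powR0 ?mul0r// gt_eqF. Qed.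

Lemma mittag_leffler_ml_fun x : x `^ (a - 1) * mittag_leffler a a (l * x `^ a) = f x.
Proof. by rewrite mittag_lefflerE. Qed.

Lemma mittag_leffler_ml_fun1 x :
  x `^ (a - 2) * mittag_leffler a (a - 1) (l * x `^ a) = f1 x.
Proof. by rewrite mittag_lefflerE. Qed.

Local Opaque ml_fun ml_fun1 ml_fun2 ml_fun3.

Lemma is_derive_powser_comb g r p p' c d x : entire c -> entire d -> 0 < x ->
  is_derive x 1 (fun x => g * (powser a p c x - r * powser a p' d x))
    (g * (powser a (p - 1) (fun k => (p + a * k%:R) * c k) x -
          r * powser a (p' - 1) (fun k => (p' + a * k%:R) * d k) x)).
Proof.
move=> ec ed x0.
have h1 := @is_derive_powser _ a p c x ec x0.
have h2 := @is_derive_powser _ a p' d x ed x0.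
exact: (is_deriveZ g (is_deriveB h1 (is_deriveZ r h2))).
Qed.

Lemma wronskian_root_lt2 t : a < 2 -> 0 < t ->
  (forall s, 0 < s <= t -> 0 < f s) -> (forall s, 0 < s < t -> 0 < q s) ->
  q t = 0 -> False.
Proof.
move=> a_lt2 t0 f0 q0 qt.
have ft : 0 < f t by apply: f0; rewrite t0 lexx.
have [r rE] : exists r, r = f1 t / f t by eexists.
pose b := 2 - a.
have b01 : 0 < b < 1.
  by rewrite /b subr_gt0 a_lt2 ltrBlDr -ltrBlDl (_ : 2 - 1 = 1)//; ring.
pose w s := pser a (a - 1) c1 s - r * pser a a c0 s.
have wE s : 0 < s -> w s = f1 s - r * f s.
  by move=> s0; rewrite /w -ml_fun_pser// -ml_fun1_pser.
have w_ge0 s : 0 < s < t -> 0 < f1 s - r * f s.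
  move=> /andP[s0 st]; have fs : 0 < f s by apply: f0; rewrite s0 ltW.
  have h : r < f1 s / f s.
    rewrite rE; apply: (ratio_decr s0 st) => z /andP[sz zt].
      by apply: f0; rewrite (lt_le_trans s0).
    by apply: q0; rewrite (lt_trans s0).
  by move: h; rewrite ltr_pdivlMr// subr_gt0.
have dw s : 0 < s -> is_derive s 1 (fun s => f1 s - r * f s) (f2 s - r * f1 s).
  move=> s0; apply: is_deriveB; first exact: is_derive_ml_fun1.
  exact: (is_deriveZ r (is_derive_ml_fun s0)).
have ddw s : 0 < s -> is_derive s 1 (fun s => f2 s - r * f1 s) (f3 s - r * f2 s).
  move=> s0; apply: is_deriveB; first exact: is_derive_ml_fun2.
  exact: (is_deriveZ r (is_derive_ml_fun1 s0)).
have ftn : f t != 0 by rewrite gt_eqF.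
have wt : f1 t - r * f t = 0 by rewrite rE (divfK ftn) subrr.
(* Multiplying by f(t) turns this derivative into -q(t), by the choice of r. *)
have wt' : f2 t - r * f1 t = 0.
  apply: (mulfI ftn); rewrite mulr0; transitivity (- q t); last by rewrite qt oppr0.
  rewrite /wronskian rE; move: ftn.
  by generalize (f t) (f1 t) (f2 t) => A B D A0; field.
have cw s : 0 < s -> {for s, continuous (fun s => f1 s - r * f s)}.
  move=> s0; apply/differentiable_continuous/derivable1_diffP.
  by have [] := dw s s0.
(* Any compact interval inside ]0, t[ would do; compactness gives [w] a positive lower bound
   there. *)
have [d d0 wd] : exists2 d : R, 0 < d & forall s, t / 4 <= s <= t / 2 -> d <= w s.
  have [|||d d0 hd] := @positive_lower_bound _ (fun s => f1 s - r * f s) (t / 4) (t / 2).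
  - by lra.
  - by move=> s /andP[ts st]; apply: cw; lra.
  - by move=> s /andP[ts st]; apply: w_ge0; apply/andP; split; lra.
  exists d => // s /[dup] /andP[ts _] /hd.
  by rewrite wE//; lra.
have [C C0 wC] : exists2 C : R, 0 <= C &
    forall s, t <= s <= t + 2 -> `|w s| <= C * (s - t) ^+ 2.
  have h1 x : t <= x <= t + 2 ->
      is_derive x 1 (fun s => f1 s - r * f s) (f2 x - r * f1 x).
    by move=> /andP[tx _]; apply: dw; exact: lt_le_trans tx.
  have h2 x : t <= x <= t + 2 ->
      is_derive x 1 (fun s => f2 s - r * f1 s) (f3 x - r * f2 x).
    by move=> /andP[tx _]; apply: ddw; exact: lt_le_trans tx.
  have h3 x : t <= x <= t + 2 -> {for x, continuous (fun s => f3 s - r * f2 s)}.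
    move=> /andP[tx _]; have x0 := lt_le_trans t0 tx.
    exact: (cvgB (continuous_ml_fun3 x0) (cvgM (cvg_cst r) (continuous_ml_fun2 x0))).
  have [C C0 hC] := quadratic_contact (ler0n R 2) h1 h2 h3 wt wt'.
  exists C => // s /[dup] /andP[ts _] /hC.
  by rewrite wE//; exact: lt_le_trans ts.
have ea1 : entire (ml_coef l a (0 + 1)) by apply: entire_ml_coef; [exact: ltW|lra].
have ea2 : entire (ml_coef l a (1 + 1)) by apply: entire_ml_coef; [exact: ltW|lra].
have [b0 b1] := andP b01.
(* Closed form of the fractional integral of [w]: order b = 2 - a moves the parameters a - 1 and a
   to 1 and 2. The leading exponents are then 0 and 1, exactly those killed by two derivatives. *)
pose V x := Gamma b *
  (powser a 0 (ml_coef l a (0 + 1)) x - r * powser a 1 (ml_coef l a (1 + 1)) x).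
pose d1 k := (0 + a * k%:R) * ml_coef l a (0 + 1) k.
pose d2 k := (1 + a * k%:R) * ml_coef l a (1 + 1) k.
pose d11 k := (0 - 1 + a * k%:R) * d1 k.
pose d22 k := (1 - 1 + a * k%:R) * d2 k.
have ed1 : entire d1 by exact: entireM_affine.
have ed2 : entire d2 by exact: entireM_affine.
have ed11 : entire d11 by exact: entireM_affine.
have ed22 : entire d22 by exact: entireM_affine.
pose V1 x := Gamma b * (powser a (0 - 1) d1 x - r * powser a (1 - 1) d2 x).
pose V2 x := Gamma b * (powser a (0 - 1 - 1) d11 x - r * powser a (1 - 1 - 1) d22 x).
have V2E x : 0 < x -> V2 x = Gamma b * l * (f1 x - r * f x).
  move=> x0; rewrite /V2.
  have -> : powser a (0 - 1 - 1) d11 x = l * f1 x.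
    by rewrite ml_fun1E; exact: (@powser_ml_second 0 x (lexx 0) (mul0r _) x0).
  have -> : powser a (1 - 1 - 1) d22 x = l * f x.
    have e1 : (1 : R) * (1 - 1) = 0 by rewrite subrr mulr0.
    by rewrite ml_funE; exact: (@powser_ml_second 1 x ler01 e1 x0).
  by generalize (f1 x) (f x) (Gamma b) => y z g; ring.
have wI x : 0 < x -> has_integral (fun s => w s * pospow b (x - s)) (V x).
  move=> x0.
  have e1 : (0 + 1 : R) = a - 1 + b by rewrite /b; ring.
  have e2 : (1 + 1 : R) = a + b by rewrite /b; ring.
  have h1 := has_integral_pser_ml b0 a10 x0 e1.
  have h2 := has_integral_pser_ml b0 a0 x0 e2.
  have := has_integralB h1 (has_integralZ r h2).
  rewrite !addrK.
  have -> : (fun s => pser a (a - 1) (ml_coef l a (a - 1)) s * pospow b (x - s) -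
      r * (pser a a (ml_coef l a a) s * pospow b (x - s))) =
      (fun s => w s * pospow b (x - s)).
    by apply/funext => s; rewrite /w mulrBl mulrA.
  have aux (g y z : R) : g * y - r * (g * z) = g * (y - r * z) by ring.
  by rewrite aux.
have VE x : 0 < x -> V x = (\int[lebesgue_measure]_s (w s * pospow b (x - s)))%R.
  by move=> /wI[].
have iw x : 0 < x -> (@lebesgue_measure R).-integrable [set: R]
    (fun s => (w s * pospow b (x - s))%:E).
  by move=> /wI[].
have w_le0 s : s <= 0 -> w s = 0.
  by move=> s0; rewrite /w (pser_le0 a (a - 1) c1 s0) (pser_le0 a a c0 s0) mulr0 subrr.
have w_ge0' s : 0 < s < t -> 0 <= w s.
  by move=> st; have /andP[s0 _] := st; rewrite wE//; exact/ltW/w_ge0.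
have dV x : 0 < x -> is_derive x 1 V (V1 x).
  by move=> x0; exact: is_derive_powser_comb.
have dV1 x : 0 < x -> is_derive x 1 V1 (V2 x).
  by move=> x0; exact: is_derive_powser_comb.
have k1 : {for t, continuous (powser a (0 - 1 - 1) d11)} by exact: continuous_powser.
have k2 : {for t, continuous (powser a (1 - 1 - 1) d22)} by exact: continuous_powser.
have cV2 : {for t, continuous V2}.
  exact: (cvgM (cvg_cst (Gamma b)) (cvgB k1 (cvgM (cvg_cst r) k2))).
have V20 : V2 t = 0 by rewrite V2E// wt mulr0.
have u0 : 0 < t / 4 by rewrite divr_gt0.
have uv : t / 4 < t / 2 by lra.
have vt : t / 2 < t by lra.
exact: (tangency_absurd b01 u0 uv vt d0 C0 iw w_le0 w_ge0' wd wC VE dV dV1 cV2 V20).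
Qed.

(** Since f'' = l f, the expression equals f'^2 - l f^2 and has zero derivative; its value at t is
    therefore the positive one at t/2. *)
Lemma wronskian_root_eq2 t : a = 2 -> 0 < t ->
  (forall s, 0 < s < t -> 0 < q s) -> q t = 0 -> False.
Proof.
move=> a_2 t0 q0 qt.
have qE x : 0 < x -> q x = f1 x * f1 x - l * (f x * f x).
  move=> x0; rewrite /wronskian (ml_fun2_eq2 a_2 x0).
  by generalize (f x) (f1 x) => y z; ring.
have tt : t / 2 < t by lra.
have dq x : t / 2 <= x <= t -> is_derive x 1 (fun x => f1 x * f1 x - l * (f x * f x)) 0.
  move=> /andP[tx _]; have x0 : 0 < x by apply: lt_le_trans tx; rewrite divr_gt0.
  have h1 := is_derive_ml_fun1 x0; have h0 := is_derive_ml_fun x0.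
  have h := is_deriveB (is_deriveM h1 h1) (is_deriveZ l (is_deriveM h0 h0)).
  apply: is_derive_eq h _; rewrite (ml_fun2_eq2 a_2 x0) /GRing.scale/=.
  by generalize (f x) (f1 x) => y z; ring.
have t20 : 0 < t / 2 by rewrite divr_gt0.
have := derive0_cst tt dq; rewrite -(qE t t0) -(qE (t / 2) t20) qt => e.
have : 0 < q (t / 2) by apply: q0; rewrite t20.
by rewrite -e ltxx.
Qed.

Lemma wronskian_gt0 T : (forall s, 0 < s <= T -> 0 < f s) ->
  forall x, 0 < x <= T -> 0 < q x.
Proof.
move=> f0 x /andP[x0 xT]; rewrite ltNge; apply/negP => qx.
have [e e0 qe] := wronskian_gt0_near0.
have [t [/andP[t0 tx] qt qs]] := first_zero e0 qe continuous_wronskian x0 qx.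
have := a2; rewrite le_eqVlt => /predU1P[a_2|a_lt2].
  exact: wronskian_root_eq2 a_2 t0 qs qt.
apply: wronskian_root_lt2 a_lt2 t0 _ qs qt => s /andP[s0 st].
by apply: f0; rewrite s0 (le_trans st)// (le_trans tx).
Qed.

Lemma ml_fun_gt0 T : (forall s, 0 < s <= T -> 0 < f1 s) ->
  forall x, 0 < x <= T -> 0 < f x.
Proof.
move=> f10 x /andP[x0 xT]; have [e e0 fe] := ml_fun_gt0_near0.
apply: (increasing_gt0 e0 fe _ _ x0) => y /andP[y0 yx].
  exact: is_derive_ml_fun.
by apply: f10; rewrite y0 (le_trans yx).
Qed.

Lemma ml_fun_cross s t : (forall x, 0 < x <= 1 -> 0 < f1 x) ->
  0 < s -> s < t -> t < 1 -> f (t - s) * f1 1 < f t * f1 (1 - s).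
Proof.
move=> f10 s0 st t1.
have f0 := ml_fun_gt0 f10; have q0 := wronskian_gt0 f0.
apply: (logconcave_cross f0 _ _ _ s0 st t1).
- by move=> x /andP[x0 _]; exact: is_derive_ml_fun.
- move=> x y x0 xy y1; apply: (ratio_decr x0 xy) => z /andP[xz zy].
    by apply: f0; rewrite (lt_le_trans x0)//= (le_trans zy).
  by apply: q0; rewrite (lt_trans x0)//= (le_trans (ltW zy)).
- by apply: f10; rewrite ltr01 lexx.
Qed.

End kernel.

(** * Sign of the Green's function *)
Local Opaque ml_fun ml_fun1.

Section positivity.
Context {R : realType}.
Variables (a l l1 : R).
Hypothesis a12 : 1 < a <= 2.
Hypothesis hl1 : largest_negative_zero (fun l => mittag_leffler a (a - 1) l) l1.

Let a1 : 1 < a. Proof. by case/andP: a12. Qed.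
Let a0 : 0 < a. Proof. exact: lt_trans a1. Qed.
Let a10 : 0 < a - 1. Proof. by rewrite subr_gt0. Qed.
Let E y := mittag_leffler a (a - 1) y.

(** All coefficients are positive, which settles y >= 0. For l1 < y < 0, a nonpositive value would
    yield, by the intermediate value theorem on [y, 0], a negative zero larger than [l1]. *)
Lemma mittag_leffler_gt0 y : l1 < y -> 0 < E y.
Proof.
have e1 : entire (ml_coef 1 a (a - 1)) by apply: entire_ml_coef => //; exact: ltW.
have EE x : E x = psum (ml_coef 1 a (a - 1)) x by rewrite -mittag_lefflerE mul1r.
have kp (k : nat) : 0 < ml_coef 1 a (a - 1) k.
  rewrite /ml_coef expr1n mul1r invr_gt0 Gamma_gt0// ltr_wpDl// mulr_ge0//; exact: ltW.
have Epos x : 0 <= x -> 0 < E x.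
  by move=> x0; rewrite EE; apply: psum_gt0 => // k; exact: ltW.
case: hl1 => l10 _ lmax l1y.
have [y0|y0] := leP 0 y; first exact: Epos.
rewrite ltNge; apply/negP => Ey.
have cE : {within `[y, 0], continuous E}.
  rewrite (_ : E = psum (ml_coef 1 a (a - 1))); last by apply/funext.
  by apply: continuous_subspaceT; exact: continuous_psum.
have E0 := Epos 0 (lexx 0).
have [|z] := IVT (ltW y0) cE (v := 0).
  by rewrite ge_min Ey le_max (ltW E0) orbT.
rewrite in_itv/= => /andP[yz z0] Ez.
have z0' : z < 0.
  rewrite lt_neqAle z0 andbT; apply/eqP => z00.
  have E0z : E 0 = E z by rewrite z00.
  by move: E0; rewrite E0z Ez ltxx.
have := lmax z z0' Ez; rewrite leNgt => /negP; apply.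
exact: lt_le_trans yz.
Qed.

(** For 0 < x <= 1 the argument l x^a stays above [l1]: it is nonnegative if l >= 0, and at least l
    if l < 0. *)
Lemma ml_fun1_gt0 : l1 < l -> forall x : R, 0 < x <= 1 -> 0 < ml_fun1 a l x.
Proof.
move=> l1l x /andP[x0 x1]; rewrite -mittag_leffler_ml_fun1 mulr_gt0 ?powR_gt0//.
apply: mittag_leffler_gt0; have xa0 : 0 < x `^ a by rewrite powR_gt0.
have xa1 : x `^ a <= 1.
  rewrite [leRHS](_ : 1 = 1 `^ a); last by rewrite powR1.
  by rewrite ge0_ler_powR ?nnegrE ?(ltW a0) ?(ltW x0).
have [l0|l0] := leP 0 l.
  by case: hl1 => l10 _ _; rewrite (lt_le_trans l10)// mulr_ge0// ltW.
apply: (lt_le_trans l1l); rewrite -subr_ge0 (_ : _ - l = - l * (1 - x `^ a)); last by ring.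
by rewrite mulr_ge0 ?oppr_ge0 ?subr_ge0// ltW.
Qed.

Lemma greenE (t s : R) : 0 < s < 1 ->
  green a l t s = ml_fun a l t * ml_fun1 a l (1 - s) / ml_fun1 a l 1 -
    (if s <= t then ml_fun a l (t - s) else 0).
Proof.
move=> /andP[s0 s1].
have H : t `^ (a - 1) * mittag_leffler a a (l * t `^ a) *
    mittag_leffler a (a - 1) (l * (1 - s) `^ a) /
    ((1 - s) `^ (2 - a) * mittag_leffler a (a - 1) l) =
  ml_fun a l t * ml_fun1 a l (1 - s) / ml_fun1 a l 1.
  rewrite mittag_leffler_ml_fun -[in RHS]mittag_leffler_ml_fun1.
  rewrite -[ml_fun1 a l 1]mittag_leffler_ml_fun1 !powR1 mul1r mulr1.
  (* The factor (1-s)^(2-a) in the denominator becomes (1-s)^(a-2) in the numerator, the prefactor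
     of f'(1-s). *)
  rewrite -[2 - a]opprB powRN invfM invrK.
  move: (mittag_leffler a (a - 1) (l * (1 - s) `^ a)) (mittag_leffler a (a - 1) l)^-1
    ((1 - s) `^ (a - 2)) (ml_fun a l t) => A B C D.
  by ring.
rewrite /green H; case: ifP => _; last by rewrite subr0.
by congr (_ - _); exact: mittag_leffler_ml_fun.
Qed.

Lemma green_gt0 (t s : R) : l1 < l -> 0 < t < 1 -> 0 < s < 1 -> 0 < green a l t s.
Proof.
move=> l1l /andP[t0 t1] s01; have /andP[s0 s1] := s01.
have f10 := ml_fun1_gt0 l1l.
have f11 : 0 < ml_fun1 a l 1 by apply: f10; rewrite ltr01 lexx.
have f1s : 0 < ml_fun1 a l (1 - s).
  by apply: f10; rewrite subr_gt0 s1/= lerBlDr lerDl ltW.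
have ft : 0 < ml_fun a l t by apply: (ml_fun_gt0 a12 f10); rewrite t0 ltW.
rewrite greenE//.
have P0 : 0 < ml_fun a l t * ml_fun1 a l (1 - s) / ml_fun1 a l 1.
  exact: (divr_gt0 (mulr_gt0 ft f1s) f11).
case: ifPn => [|_]; last by rewrite subr0.
(* On the diagonal the subtracted term is f(0) = 0, and the strict product inequality is needed only
   for s < t. *)
rewrite le_eqVlt => /predU1P[e|st].
  have -> : t - s = 0 by rewrite e subrr.
  by rewrite (ml_fun_0 l a12) subr0; exact: P0.
rewrite subr_gt0 ltr_pdivlMr; last exact: f11.
exact: (ml_fun_cross a12 f10 s0 st t1).
Qed.

Lemma green_eq0 : l < l1 ->
  exists t s : R, [/\ 0 < t < 1, 0 < s < 1 & green a l t s = 0].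
Proof.
move=> ll1; have [l10 El1 _] := hl1.
have l0 : l < 0 by exact: lt_trans l10.
have q01 : 0 < l1 / l < 1.
  by rewrite nmulr_rgt0// invr_lt0 l0 ltr_ndivrMr// mul1r.
have /andP[q0 q1] := q01.
pose x := (l1 / l) `^ a^-1.
have x0 : 0 < x by rewrite powR_gt0.
have x1 : x < 1.
  rewrite [ltRHS](_ : 1 = 1 `^ a^-1); last by rewrite powR1.
  by rewrite gt0_ltr_powR ?invr_gt0 ?nnegrE ?(ltW q0).
have xa : l * x `^ a = l1.
  by rewrite /x -powRrM mulVf ?gt_eqF// powRr1 ?(ltW q0)// mulrC divfK// lt_eqF.
have s0 : 0 < 1 - x by rewrite subr_gt0.
have s1 : 1 - x < 1 by rewrite ltrBlDr ltrDl.
(* Taking t < s = 1 - x selects the branch without the subtracted term, where the factor f'(1 - s) =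
   f'(x) vanishes. *)
exists ((1 - x) / 2), (1 - x); split.
- by apply/andP; split; lra.
- by rewrite s0.
rewrite greenE ?s0// (_ : 1 - (1 - x) = x); last by ring.
rewrite leNgt (_ : (1 - x) / 2 < 1 - x)/=; last by lra.
by rewrite -(mittag_leffler_ml_fun1 a l x) xa El1 mulr0 mulr0 mul0r subr0.
Qed.

End positivity.

Theorem lemma8 (R : realType) (alpha lambda1 : R)
    (halpha : 1 < alpha <= 2)
    (hlambda1 : largest_negative_zero
                  (fun l : R => mittag_leffler alpha (alpha - 1) l) lambda1)
    (lambda : R)
    (hlambda : mittag_leffler alpha (alpha - 1) lambda <> 0) :
  (forall t s : R, 0 < t < 1 -> 0 < s < 1 -> 0 < green alpha lambda t s)
  <-> lambda1 < lambda.
Proof.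
split=> [green0|ll t s]; last exact: (green_gt0 halpha hlambda1 ll).
(* Equality is excluded by [hlambda], as [lambda1] is itself a zero; below [lambda1] the Green's
   function has an interior zero. *)
rewrite ltNge le_eqVlt; apply/negP => /predU1P[e|ll].
  by apply: hlambda; rewrite e; case: hlambda1.
have [t [s [t01 s01 e]]] := green_eq0 halpha hlambda1 ll.
by have := green0 t s t01 s01; rewrite e ltxx.
Qed.
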